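(* Let $\theta>0$, let $\Omega=\{0,1\}^{\mathbb Z}$, let $\tau:\Omega\to\Omega$ be the Bernoulli shift $\tau(x)_k=x_{k-1}$, and let $\chi:\Omega\to\mathbb R$ be given by $\chi(x)=1$ if $x_{-1}=0$ and $\chi(x)=-\theta$ if $x_{-1}=1$. For every non-zero $\beta\in\mathbb R$, there exists an ergodic (for $\tau$) Borel probability measure $m$ on $\Omega$ such that $m$ is $e^{-\beta\chi}$-conformal and $m$ is of type $II_\infty$.
   Context: $\Omega=\{0,1\}^{\mathbb Z}$ carries the product topology. A Borel probability measure $m$ on $\Omega$ is $e^{-\beta\chi}$-conformal if $\frac{d(m\circ\tau)}{dm}=e^{-\beta\chi}$, i.e. $m(\tau(B))=\int_B e^{-\beta\chi}\,dm$ for every Borel set $B\subset\Omega$. Such an $m$ is quasi-invariant under $\tau$. An ergodic conformal probability measure $m$ is of type $II_\infty$ if it is of Krieger type $II_\infty$ for the $\mathbb Z$-action generated by $\tau$: $m$ is non-atomic, there is a $\sigma$-finite infinite $\tau$-invariant measure on $\Omega$ equivalent to $m$ (mutually absolutely continuous), and there is no finite non-zero $\tau$-invariant measure equivalent to $m$. Equivalently, $m$ is non-atomic and the von Neumann algebra crossed product $L^\infty(\Omega,m)\rtimes_\tau\mathbb Z$ is a type $II_\infty$ factor. *)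

(* Defs.v *)
From HB Require Import structures.
From mathcomp Require Import all_boot all_order all_algebra.
From mathcomp Require Import all_classical all_reals all_analysis.

Set Implicit Arguments.
Unset Strict Implicit.
Unset Printing Implicit Defensive.

Import Order.TTheory GRing.Theory Num.Theory.
Import numFieldNormedType.Exports.

Local Open Scope classical_set_scope.
Local Open Scope ring_scope.

Section nonsingular_dynamics.
Context (d : measure_display) (T : measurableType d) (R : realType).
Implicit Types (f : T -> T) (m mu : {measure set T -> \bar R}).

Definition ergodic f m := forall A, measurable A -> f @^-1` A = A ->
  m A = 0%E \/ m (~` A) = 0%E.

Definition invariant_measure f mu := forall A, measurable A ->
  mu (f @^-1` A) = mu A.

Definition atom m (A : set T) :=
  [/\ measurable A, (0 < m A)%E &
      forall B, measurable B -> B `<=` A -> m B = 0%E \/ m B = m A].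

Definition nonatomic m := forall A, ~ atom m A.

Definition equivalent_measures mu m := mu `<< m /\ m `<< mu.

Definition type_II_infty f m :=
  [/\ nonatomic m,
      exists mu : {sigma_finite_measure set T -> \bar R},
        [/\ mu setT = +oo%E, invariant_measure f mu & equivalent_measures mu m] &
      ~ exists mu : {finite_measure set T -> \bar R},
        [/\ mu setT <> 0%E, invariant_measure f mu & equivalent_measures mu m]].

(* d(m o f)/dm = exp(- beta chi), for bijective bimeasurable f *)
Definition conformal f (beta : R) (chi : T -> R) m :=
  forall B, measurable B ->
    m (f @` B) = (\int[m]_(x in B) (expR (- beta * chi x))%:E)%E.

End nonsingular_dynamics.

(* {0,1}^Z, with false for 0 and true for 1, with its Borel sigma-algebra *)
Definition Omega : measurableType _ :=
  g_sigma_algebraType (@open (prod_topology (fun _ : int => bool))).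

Definition bernoulli_shift (x : Omega) : Omega := fun k : int => x (k - 1).

Definition potential (R : realType) (theta : R) (x : Omega) : R :=
  if x (- 1) then - theta else 1.

(* Main.v *)
Require Import Defs.
From HB Require Import structures.
From mathcomp Require Import all_boot all_order all_algebra.
From mathcomp Require Import all_classical all_reals all_analysis.
From mathcomp Require Import measurable_realfun ring lra zify.

(* Write [a] for the symbol with cost [p > 0] and [~~ a] for the one with cost
   [- q < 0], the cost being [beta * chi].  Over the binary odometer with its
   coin-tossing measure, put a column above each sequence whose first zero has
   index [n], reading the word [a^(k n) (~~ a)^(l n)].  The lengths are chosen so
   that the total cost [p * k n - q * l n] is [\sum_(i < n) e i - e n] with
   [|e n| <= 2^-n]: then [exp (\sum_n e n * y_n)] is a bounded density on the
   base which, corrected by the cost accumulated in the column, extends to the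
   tower with the cocycle [exp (- beta * chi)].  Costs rise before they fall, so
   the density has uniformly bounded sums on columns and the conformal measure is
   finite.  Since [k n >= 4 ^ n], any [k n] consecutive steps meet the base at most
   [2 ^ n] times; hence a finite invariant measure would not charge the base.
   Reading the symbols along orbits sends everything to [{0,1}^Z]. *)

Set Implicit Arguments.
Unset Strict Implicit.
Unset Printing Implicit Defensive.

Import Order.TTheory GRing.Theory Num.Theory.
Import numFieldNormedType.Exports.

Local Open Scope classical_set_scope.
Local Open Scope ring_scope.

(** * Sequence spaces *)

(** If a conformal measure has a density with respect to an invariant one, the logarithm of that
    density changes by [- beta * chi] at each step. Bounded densities on the base thus need column
    costs that nearly cancel, while [p * K = q * L] has no positive integer solution when [p / q] is
    irrational. The remaining defects are made a coboundary of the odometer: adding one changes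
    [\sum_n e n * y_n] by [e n - \sum_(i < n) e i], where [n] is the first zero, and this dictates
    the shape imposed on the column costs. Replacing all weights by [1] on the same tower gives an
    invariant measure with the same null sets. The frequency argument for the base then serves
    twice: it shows that this measure is infinite and that no equivalent finite one exists.
    Ergodicity descends to the odometer, because a shift-invariant set is met by a column at all its
    levels or at none. *)

Lemma countable_bigcap_measurable (d : measure_display) (T : measurableType d)
  (I : countType) (P : set I) (F : I -> set T) :
  (forall i, P i -> measurable (F i)) -> measurable (\bigcap_(i in P) F i).
Proof.
move=> mF; rewrite -[X in measurable X]setCK setC_bigcap bigcup_mkcond.
apply/measurableC/countable_bigcupT_measurable; first exact: countableP.
by move=> i; case: ifPn => // /set_mem/mF/measurableC.
Qed.

(** With [I := int] this is convertible to [Omega], so one set of lemmas serves both the odometer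
    space [bits nat] and the shift space. *)
Definition bits (I : Type) : measurableType _ :=
  g_sigma_algebraType (@open (prod_topology (fun _ : I => bool))).

(** Coordinates are ordered by [pickle], so that words index the cylinders for every countable [I];
    on [nat] these are the usual initial-segment cylinders. *)
Definition cylinder (I : countType) (s : seq bool) : set (bits I) :=
  [set y : bits I | forall i : I, (pickle i < size s)%N ->
    y i = nth false s (pickle i)].

(** The empty set is added to make the family stable under intersection. *)
Definition cylinders (I : countType) : set (set (bits I)) :=
  [set C | C = set0 \/ exists s, C = @cylinder I s].

Lemma bits_cvg (I : countType) (F : set_system (bits I)) (x : bits I) :
  Filter F -> (forall i, F [set y : bits I | y i = x i]) ->
  (F : set_system (prod_topology (fun _ : I => bool))) -->
    (x : prod_topology (fun _ : I => bool)).
Proof.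
move=> FF Fx; apply/cvg_sup => i; apply/cvg_image.
  by apply/seteqP; split=> // b _; exists (fun=> b).
move=> B /= Bx; exists [set y : bits I | B (y i)].
  have xB : B (x i) by exact: nbhs_singleton Bx.
  by apply: filterS (Fx i) => y /= ->.
apply/seteqP; split=> [b [y By <-] //|b Bb].
by exists (fun=> b).
Qed.

(** The cylinders cut out by longer and longer initial parts of [x] generate a filter converging to
    [x] in the product topology, so one of them lies in [U]. *)
Lemma open_bits_cylinder (I : countType) (U : set (bits I)) (x : bits I) :
  open (U : set (prod_topology (fun _ : I => bool))) -> U x ->
  exists s, @cylinder I s x /\ cylinder s `<=` U.
Proof.
move=> oU Ux.
pose pre n := [seq (if unpickle k is Some i then x i else false) | k <- iota 0 n].
pose F := filter_from [set: nat] (fun n => @cylinder I (pre n)).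
have nth_pre n i : (pickle (i : I) < n)%N -> nth false (pre n) (pickle i) = x i.
  by move=> h; rewrite (nth_map 0%N) ?size_iota// nth_iota// add0n pickleK.
have size_pre n : size (pre n) = n by rewrite size_map size_iota.
have FF : Filter F.
  apply: filter_from_filter; first by exists 0%N.
  move=> m n _ _; exists (maxn m n) => // y yC; split=> i; rewrite size_pre => h;
  rewrite nth_pre// yC ?size_pre ?nth_pre//; lia.
have cF : (F : set_system (prod_topology (fun _ : I => bool))) -->
    (x : prod_topology (fun _ : I => bool)).
  apply: bits_cvg => i; exists (pickle i).+1 => // y yC /=.
  by rewrite yC ?size_pre// nth_pre.
have [n _ nU] : F U by apply: cF; exact: open_nbhs_nbhs.
exists (pre n); split => // i; rewrite size_pre => h.
by rewrite nth_pre.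
Qed.

Lemma measurable_coord (I : eqType) (i : I) :
  measurable_fun [set: bits I] (fun y => y i).
Proof.
apply: (@measurable_fun_bool _ _ _ _ true).
rewrite setTI; apply: sub_sigma_algebra.
have /(@continuousP (prod_topology (fun _ : I => bool)) bool) :=
  @proj_continuous I (fun=> bool) i.
by apply; exact: discrete_open.
Qed.

Lemma measurable_coord_eq (I : eqType) (i : I) (b : bool) :
  measurable [set y : bits I | y i = b].
Proof.
rewrite -[X in measurable X]setTI.
exact: (@measurable_coord I i measurableT [set b]).
Qed.

Lemma measurable_bits_set1 (I : countType) (x : bits I) : measurable [set x].
Proof.
have -> : [set x] = \bigcap_(i in [set: I]) [set y : bits I | y i = x i].
  apply/seteqP; split => [y -> //|y H]; apply/funext => i; exact: H.
by apply: countable_bigcap_measurable => i _; exact: measurable_coord_eq.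
Qed.

Lemma measurable_cylinder (I : countType) s : measurable (@cylinder I s).
Proof.
have -> : @cylinder I s = \bigcap_(i in [set i : I | (pickle i < size s)%N])
    [set y : bits I | y i = nth false s (pickle i)].
  by apply/seteqP; split => y yC i; exact: yC.
apply: countable_bigcap_measurable => i _.
exact: measurable_coord_eq.
Qed.

(** An open set is the union of the cylinders inside it, a countable union because there are
    countably many words. *)
Lemma measurable_bitsE (I : countType) :
  @measurable _ (bits I) = <<s @cylinders I >>.
Proof.
apply/seteqP; split; last first.
  apply: smallest_sub; first exact: sigma_algebra_measurable.
  by move=> C [->|[s ->]] //; exact: measurable_cylinder.
apply: smallest_sub; first exact: smallest_sigma_algebra.
move=> U oU.
have -> : U = \bigcup_(s in [set s | @cylinder I s `<=` U]) cylinder s.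
  apply/seteqP; split => [x Ux|x [s sU]]; last exact: sU.
  by have [s [xs sU]] := open_bits_cylinder oU Ux; exists s.
rewrite bigcup_mkcond.
pose T : measurableType _ := g_sigma_algebraType (@cylinders I).
apply: (@countable_bigcupT_measurable _ T); first exact: countableP.
by move=> s; case: ifP => _; apply: sub_sigma_algebra; [right; exists s|left].
Qed.

Lemma measurable_bits (d : measure_display) (T : measurableType d)
  (I : countType) (f : T -> bits I) :
  (forall i, measurable_fun setT (fun t => f t i)) -> measurable_fun setT f.
Proof.
move=> mf; apply: (measurability _ (@measurable_bitsE I)) => _ [C [->|[s ->]] <-].
  by rewrite preimage_set0 setI0.
rewrite setTI.
have -> : f @^-1` (@cylinder I s) =
    \bigcap_(i in [set i : I | (pickle i < size s)%N])
      (fun t => f t i) @^-1` [set nth false s (pickle i)].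
  by apply/seteqP; split => y yC i; exact: yC.
apply: countable_bigcap_measurable => i _.
by rewrite -[X in measurable X]setTI; exact: (mf i measurableT [set _]).
Qed.

(** Two cylinders are nested or disjoint, so they form a pi-system; the empty word gives the whole
    space. *)
Lemma bits_measure_unique (R : realType) (I : countType)
  (m1 m2 : {measure set (bits I) -> \bar R}) :
  (m1 setT < +oo)%E -> (forall s, m1 (@cylinder I s) = m2 (cylinder s)) ->
  forall A, measurable A -> m1 A = m2 A.
Proof.
move=> m1oo m12.
have cT : @cylinder I [::] = setT by apply/seteqP; split.
move=> A mA.
apply: (@measure_unique _ R (bits I) (@cylinders I) (fun=> setT)
  (@measurable_bitsE I) _ _ _ m1 m2) => //.
- suff leI s t : (size s <= size t)%N -> @cylinders I (cylinder s `&` cylinder t).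
    move=> _ _ [->|[s ->]] [->|[t ->]]; rewrite ?setI0 ?set0I; try by left.
    case: (leqP (size s) (size t)) => [|/ltnW] st; first exact: leI.
    by rewrite setIC; exact: leI.
  move=> st; have [e|/set0P[y [ys yt]]] := eqVneq (@cylinder I s `&` cylinder t) set0.
    by rewrite e; left.
  right; exists t; apply/seteqP; split => [z []//|z zt]; split => // i si.
  have ti := leq_trans si st.
  by rewrite zt// -yt// ys.
- by move=> _; right; exists [::].
- by apply/seteqP; split => // x _; exists 0%N.
- by move=> _ [->|[s ->//]]; rewrite !measure0.
Qed.

(** * The coin-tossing measure *)

Lemma normalized_probability (d : measure_display) (T : measurableType d)
  (R : realType) (m : {measure set T -> \bar R}) :
  m setT != 0%E -> (m setT < +oo)%E ->
  exists P : probability T R, forall A, P A = (m A * (fine (m setT))^-1%:E)%E.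
Proof.
move=> m0 moo; exists (mnormalize m (dirac point : probability T R)) => A.
by rewrite /mnormalize/= /mnormalize (negbTE m0) (lt_eqF moo).
Qed.

Definition doubling (R : realType) (y : R) : R :=
  if y < 2^-1 then 2 * y else 2 * y - 1.

Definition digits (R : realType) (y : R) : bits nat :=
  fun n => 2^-1 <= iter n (@doubling R) y.

Lemma digits_doubling (R : realType) (y : R) n :
  digits (doubling y) n = digits y n.+1.
Proof. by rewrite /digits iterSr. Qed.

Lemma measurable_digits (R : realType) :
  measurable_fun [set: measurableTypeR R] (@digits R).
Proof.
have md : measurable_fun [set: measurableTypeR R] (@doubling R).
  apply: measurable_fun_ifT.
  - by apply: measurable_fun_ltr.
  - exact: mulrl_measurable.
  - by apply: measurable_funB => //; exact: mulrl_measurable.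
have mi n : measurable_fun [set: measurableTypeR R] (iter n (@doubling R)).
  elim: n => [|n IH]; first exact: measurable_id.
  exact: (measurableT_comp md IH).
apply: measurable_bits => n; exact: measurable_fun_ler.
Qed.

Lemma digits_cylinder (R : realType) (s : seq bool) :
  exists a : R, [/\ 0 <= a, a + 2^-1 ^+ size s <= 1 &
   `[0, 1[ `&` @digits R @^-1` (cylinder s) = `[a, a + 2^-1 ^+ size s[%classic].
Proof.
elim: s => [|b s [a [a0 a1 E]]].
  exists 0; rewrite /= expr0 add0r; split => //.
  by apply/seteqP; split => [y [] //|y]; split.
have cylS y : cylinder (b :: s) (digits y) <->
    (2^-1 <= y) = b /\ cylinder s (digits (doubling y)).
  split => [H|[H1 H2] [|i] /= si]; last 2 first.
  - exact: H1.
  - by rewrite -digits_doubling H2.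
  split; first exact: (H 0%N).
  by move=> i si; rewrite digits_doubling; exact: (H i.+1).
have Ey y : (0 <= y < 1 /\ cylinder s (digits y)) <->
    a <= y < a + 2^-1 ^+ size s.
  by have := congr1 (fun A => A y) E; rewrite /= !in_itv/= => ->.
pose h : R := 2^-1 ^+ size s.
have h0 : 0 < h by rewrite exprn_gt0.
(* Prepending the digit [b] applies an inverse branch of the doubling map: the interval is halved,
   then moved by one half if [b] is [true]. *)
exists (a / 2 + (if b then 2^-1 else 0)); rewrite /= exprS -/h.
move: a1; rewrite -/h => a1.
split; [by case: b {cylS}; lra|by case: b {cylS}; lra|].
apply/seteqP; split => y /=; rewrite in_itv/=.
- move=> [y01 /cylS[yb ys]].
  have d01 : 0 <= doubling y < 1.
    by rewrite /doubling; case: ltP => ?; lra.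
  have /Ey := conj d01 ys; rewrite -/h /doubling in_itv/=.
  by case: ltP yb => yb <- /=; lra.
- rewrite in_itv/= => yab.
  have yb : (2^-1 <= y) = b.
    by case: b {cylS} yab => /= yab; [apply/idP|apply/negbTE; rewrite -ltNge]; lra.
  have : a <= doubling y < a + h.
    by rewrite /doubling ltNge yb; case: b {cylS yb} yab => /=; lra.
  move=> /Ey[_ ys]; split; last exact/cylS.
  by case: b {cylS yb} yab => /=; lra.
Qed.

(** The binary digits of a uniform point of [[0, 1[] are independent fair coins. *)
Lemma coin_measure (R : realType) :
  exists nu : probability (bits nat) R,
    forall s, nu (cylinder s) = (2^-1 ^+ size s)%:E.
Proof.
pose lam : {measure set (measurableTypeR R) -> \bar R} :=
  mrestr (@lebesgue_measure R) (measurable_itv `[0, 1[).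
pose pf : {measure set (bits nat) -> \bar R} := pushforward lam (@digits R).
pose m := pf (@measurable_digits R).
have mc s : m (cylinder s) = (2^-1 ^+ size s)%:E.
  have [a [_ _ E]] := @digits_cylinder R s.
  rewrite /m/= /pushforward /lam/= /mrestr setIC E lebesgue_measure_itv/= lte_fin.
  by rewrite ltrDl exprn_gt0// -EFinD addrAC subrr add0r.
have mT : m setT = 1%:E.
  by rewrite -(mc [::]); congr (m _); apply/seteqP; split.
have [P PE] : exists P : probability (bits nat) R,
    forall A, P A = (m A * (fine (m setT))^-1%:E)%E.
  by apply: normalized_probability; rewrite mT// ltry.
by exists P => s; rewrite PE mT /= invr1 mule1 mc.
Qed.

(** * The binary odometer *)

Definition constant_on (b : bool) (i k : nat) (y : bits nat) : bool :=
  all (fun j => y j == b) (index_iota i k).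

Lemma constant_onP b i k (y : bits nat) :
  reflect (forall j, (i <= j < k)%N -> y j = b) (constant_on b i k y).
Proof.
apply: (iffP allP) => H j; first by rewrite -mem_index_iota => /H/eqP.
by rewrite mem_index_iota => /H ->.
Qed.

(* Addition of [2 ^ i] with carry to the right, digits being listed from the
   least significant one. *)
Definition add_pow (i : nat) (y : bits nat) : bits nat :=
  fun k => if (i <= k)%N && constant_on true i k y then ~~ y k else y k.

Definition sub_one (y : bits nat) : bits nat :=
  fun k => if constant_on false 0 k y then ~~ y k else y k.

Arguments add_pow : simpl never.
Arguments sub_one : simpl never.

(** The carry turns into zeros exactly the ones that it crosses, so the borrow of [sub_one] flips
    the same positions back; this makes the two maps mutually inverse. *)
Lemma constant_on_add k (y : bits nat) :
  constant_on false 0 k (add_pow 0 y) = constant_on true 0 k y.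
Proof.
apply/constant_onP/constant_onP => H j /= jk; last first.
  have -> : add_pow 0 y j = ~~ y j; last by rewrite (H j).
  rewrite /add_pow /= ifT//; apply/constant_onP => l lj; apply: H; lia.
elim/ltn_ind: j jk => j IH jk.
have := H j jk; rewrite /add_pow /= ifT; first by case: (y j).
by apply/constant_onP => l lj; apply: IH; lia.
Qed.

Lemma constant_on_sub k (y : bits nat) :
  constant_on true 0 k (sub_one y) = constant_on false 0 k y.
Proof.
apply/constant_onP/constant_onP => H j /= jk; last first.
  have -> : sub_one y j = ~~ y j; last by rewrite (H j).
  rewrite /sub_one /= ifT//; apply/constant_onP => l lj; apply: H; lia.
elim/ltn_ind: j jk => j IH jk.
have := H j jk; rewrite /sub_one /= ifT; first by case: (y j).
by apply/constant_onP => l lj; apply: IH; lia.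
Qed.

Lemma add_powK : cancel (add_pow 0) sub_one.
Proof.
move=> y; apply/funext => k; rewrite /sub_one constant_on_add /add_pow /=.
by case: (constant_on _ _ _ _); rewrite ?negbK.
Qed.

Lemma sub_oneK : cancel sub_one (add_pow 0).
Proof.
move=> y; apply/funext => k; rewrite /add_pow /= constant_on_sub /sub_one.
by case: (constant_on _ _ _ _); rewrite ?negbK.
Qed.

Lemma add_pow_false i (y : bits nat) : y i = false ->
  add_pow i y = fun k => if k == i then true else y k.
Proof.
move=> yi; apply/funext => k; rewrite /add_pow.
case: (ltngtP k i) => [//|ik|->] /=.
  by case: constant_onP => // /(_ i); rewrite yi leqnn => /(_ ik).
by rewrite yi ifT//; apply/constant_onP => j; lia.
Qed.

Lemma add_pow_true i (y : bits nat) : y i = true ->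
  add_pow i y = fun k => if k == i then false else add_pow i.+1 y k.
Proof.
move=> yi; apply/funext => k; rewrite /add_pow.
case: (ltngtP k i) => [//|ik|->] /=.
  congr (if _ then _ else _); apply/constant_onP/constant_onP => H j jk.
    by apply: H; lia.
  by have [->//|ji] := eqVneq j i; apply: H; lia.
by rewrite yi ifT//; apply/constant_onP => j; lia.
Qed.

Lemma eq_add_pow i (y z : bits nat) : (forall k, (i <= k)%N -> y k = z k) ->
  forall k, (i <= k)%N -> add_pow i y k = add_pow i z k.
Proof.
move=> yz k ik; rewrite /add_pow ik /= yz//; congr (if _ then _ else _).
by apply: eq_in_all => j; rewrite mem_index_iota => /andP[ij _]; rewrite yz.
Qed.

Lemma add_pow_low i (y : bits nat) k : (k < i)%N -> add_pow i y k = y k.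
Proof. by rewrite /add_pow ltnNge => /negbTE ->. Qed.

Lemma add_pow_add_pow i (y : bits nat) :
  add_pow i (add_pow i y) = add_pow i.+1 y.
Proof.
case yi: (y i).
  have E := add_pow_true yi.
  have zi : add_pow i y i = false by rewrite E eqxx.
  rewrite (add_pow_false zi); apply/funext => k.
  have [->|ki] := eqVneq k i; first by rewrite add_pow_low.
  by rewrite E (negbTE ki).
have E := add_pow_false yi.
have zi : add_pow i y i = true by rewrite E eqxx.
rewrite (add_pow_true zi); apply/funext => k.
case: (ltngtP k i) => [ki|ik|->].
- by rewrite 3?add_pow_low//; lia.
- by apply: eq_add_pow => // j ij; rewrite E; case: eqP => //; lia.
- by rewrite add_pow_low.
Qed.

(** This iterate fixes the digits below [i] and flips digit [i], which is the symmetry behind the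
    ergodicity of the odometer. *)
Lemma iter_add_pow i : iter (2 ^ i) (add_pow 0) =1 add_pow i.
Proof.
elim: i => // i IH y.
by rewrite expnS mul2n -addnn iterD !IH add_pow_add_pow.
Qed.

(** The time [i] is [2 ^ N - 1] minus the number written by the first [N] digits of [y]; adding it
    causes no carry past them. The quantification over [z] lets the induction change digit [N], and
    later lets two points be compared at the same time. *)
Lemma reach_ones N (y : bits nat) : exists2 i, (i < 2 ^ N)%N &
  forall z : bits nat, (forall j, (j < N)%N -> z j = y j) ->
  (forall j, (j < N)%N -> iter i (add_pow 0) z j = true) /\
  (forall j, (N <= j)%N -> iter i (add_pow 0) z j = z j).
Proof.
elim: N => [|N [i iN IH]]; first by exists 0%N => // z _; split.
have [yN|yN] := boolP (y N).
  exists i => [|z zy]; first by rewrite (leq_trans iN)// leq_exp2l.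
  have [|H1 H2] := IH z; first by move=> j jN; apply: zy; lia.
  split => j jN; last by rewrite H2//; lia.
  have [->|jN'] := eqVneq j N; last by rewrite H1//; lia.
  by rewrite H2// zy.
(* The [2 ^ N] steps are done first: they only switch digit [N] on, and the induction hypothesis
   applies to the resulting point. *)
exists (i + 2 ^ N)%N => [|z zy]; first by rewrite expnS; lia.
have zN : z N = false by rewrite zy//; exact/negbTE.
rewrite iterD iter_add_pow add_pow_false//.
have [|H1 H2] := IH (fun k => if k == N then true else z k).
  by move=> j jN; case: eqP => [|_]; [lia|apply: zy; lia].
split => j jN; last by rewrite H2; [case: eqP => //; lia|lia].
have [->|jN'] := eqVneq j N; last by rewrite H1//; lia.
by rewrite H2// eqxx.
Qed.

Lemma measurable_constant_on b i k : measurable_fun setT (constant_on b i k).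
Proof.
rewrite /constant_on; elim: (index_iota i k) => /= [|j s IH].
  exact: measurable_cst.
apply: measurable_and => //.
apply: (measurableT_comp (f := fun c : bool => c == b)) => //.
exact: measurable_coord.
Qed.

Lemma measurable_add_pow i : measurable_fun setT (add_pow i).
Proof.
apply: measurable_bits => k; rewrite /add_pow.
apply: measurable_fun_ifT.
- by apply: measurable_and; [exact: measurable_cst|exact: measurable_constant_on].
- by apply: measurable_neg; exact: measurable_coord.
- exact: measurable_coord.
Qed.

Lemma measurable_sub_one : measurable_fun setT sub_one.
Proof.
apply: measurable_bits => k; rewrite /sub_one.
apply: measurable_fun_ifT.
- exact: measurable_constant_on.
- by apply: measurable_neg; exact: measurable_coord.
- exact: measurable_coord.
Qed.

Lemma cylinder_mkseq (v : bits nat) n :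
  cylinder (mkseq v n) = [set y : bits nat | forall i, (i < n)%N -> y i = v i].
Proof.
apply/seteqP; split => y H i.
  by move=> ni; have := H i; rewrite size_mkseq => /(_ ni); rewrite nth_mkseq.
by rewrite size_mkseq => ni; rewrite nth_mkseq//; exact: H.
Qed.

Lemma cylinder_mkseq_nth s : @cylinder nat s = cylinder (mkseq (nth false s) (size s)).
Proof. by rewrite mkseq_nth. Qed.

(** Carries and borrows move to the right only, so the first digits of the result depend on the
    first digits of the argument. Preimages of cylinders keep their length, whence the invariance of
    the coin measure. *)
Lemma add_pow_preimage_cylinder s :
  add_pow 0 @^-1` (cylinder s) = cylinder (mkseq (sub_one (nth false s)) (size s)).
Proof.
rewrite cylinder_mkseq_nth !cylinder_mkseq.
have agree (y z : bits nat) n : (forall i, (i < n)%N -> y i = z i) ->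
    forall i, (i < n)%N -> add_pow 0 y i = add_pow 0 z i /\ sub_one y i = sub_one z i.
  move=> yz i ni; rewrite /add_pow /sub_one /= yz//.
  have yzi b : constant_on b 0 i y = constant_on b 0 i z.
    apply: eq_in_all => j; rewrite mem_index_iota => /andP[_ ji].
    by rewrite yz// (ltn_trans ji).
  by rewrite !yzi.
apply/seteqP; split => y H i ni.
  by have [_ <-] := agree _ _ _ H i ni; rewrite add_powK.
have [-> _] := agree _ _ _ H i ni.
by rewrite sub_oneK.
Qed.

Lemma cylinder_rcons s c (y : bits nat) :
  cylinder (rcons s c) y <-> cylinder s y /\ y (size s) = c.
Proof.
split=> [H|[H yc] i].
  split=> [i si|].
    by have := H i; rewrite size_rcons nth_rcons si ltnS (ltnW si) => ->.
  by have := H (size s); rewrite size_rcons nth_rcons ltnn eqxx => ->.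
rewrite size_rcons nth_rcons ltnS leq_eqVlt => /orP[|si]; last by rewrite si H.
by move=> /eqP e; rewrite e ltnn eqxx -[RHS]yc; congr (y _).
Qed.

Section coin.
Context (R : realType) (nu : probability (bits nat) R).
Hypothesis nuE : forall s, nu (cylinder s) = (2^-1 ^+ size s)%:E.

Lemma coin_add_one A : measurable A -> nu (add_pow 0 @^-1` A) = nu A.
Proof.
move=> mA.
pose pf : {measure set (bits nat) -> \bar R} := pushforward nu (add_pow 0).
pose m := pf (@measurable_add_pow 0).
apply: (@bits_measure_unique _ _ m nu) => //.
  by rewrite /m/= /pushforward preimage_setT probability_setT ltry.
by move=> s; rewrite /m/= /pushforward add_pow_preimage_cylinder !nuE size_mkseq.
Qed.

Lemma coin_iter_add_one n A : measurable A ->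
  nu (iter n (add_pow 0) @^-1` A) = nu A.
Proof.
elim: n A => // n IH A mA.
have -> : iter n.+1 (add_pow 0) @^-1` A =
    iter n (add_pow 0) @^-1` (add_pow 0 @^-1` A) by [].
rewrite IH ?coin_add_one//.
by rewrite -[X in measurable X]setTI; exact: measurable_add_pow.
Qed.

Lemma coin_set1 (x : bits nat) : nu [set x] = 0%E.
Proof.
have mx := measurable_bits_set1 x.
have le n : (nu [set x] <= (2^-1 ^+ n)%:E)%E.
  rewrite -{1}(size_mkseq x n) -nuE le_measure ?inE//; first exact: measurable_cylinder.
  by rewrite cylinder_mkseq => y ->.
apply/eqP; rewrite eq_le measure_ge0 andbT.
apply/lee_addgt0Pr => e e0; rewrite add0e.
have [n _ /(_ n (leqnn n)) ne] := near_infty_natSinv_expn_lt (PosNum e0).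
by apply: (le_trans (le n)); rewrite lee_fin exprVn -div1r ltW.
Qed.

(** An invariant set is independent of every cylinder: with [n = size s], the iterate [add_pow n]
    preserves [E] and the cylinder of [s] while exchanging the two halves of the latter, so [E] has
    equal measure in both. *)
Lemma coin_cylinder_invariant E s : measurable E -> add_pow 0 @^-1` E = E ->
  nu (E `&` cylinder s) = (nu E * (2^-1 ^+ size s)%:E)%E.
Proof.
move=> mE TE.
have TnE n : iter n (add_pow 0) @^-1` E = E.
  by elim: n => // k IH; rewrite -[in RHS]IH -[in RHS]TE.
elim/last_ind: s => [|s b IH].
  by rewrite expr0 mule1; congr (nu _); apply/seteqP; split => [y []//|y Ey]; split.
pose n := size s.
have mc c := @measurable_cylinder nat (rcons s c).
have flip c : iter (2 ^ n) (add_pow 0) @^-1` (E `&` cylinder (rcons s c)) =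
    E `&` cylinder (rcons s (~~ c)).
  rewrite preimage_setI TnE; congr (_ `&` _).
  have -> : iter (2 ^ n) (add_pow 0) = add_pow n.
    by apply/funext => y; rewrite iter_add_pow.
  have Hn (y : bits nat) : add_pow n y n = ~~ y n.
    by rewrite /add_pow leqnn /= ifT//; apply/constant_onP => j; lia.
  have Hl (y : bits nat) : cylinder s (add_pow n y) <-> cylinder s y.
    by split => H i si; have := H i si; rewrite add_pow_low.
  apply/seteqP; split => y.
    by move=> /cylinder_rcons[/Hl ys]; rewrite Hn => <-; apply/cylinder_rcons; rewrite negbK.
  move=> /cylinder_rcons[ys yc]; apply/cylinder_rcons.
  by rewrite Hn yc negbK; split => //; exact/Hl.
have half c : nu (E `&` cylinder (rcons s c)) = nu (E `&` cylinder (rcons s (~~ c))).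
  by rewrite -flip coin_iter_add_one//; apply: measurableI => //; exact: mc.
have : nu (E `&` cylinder s) =
    (nu (E `&` cylinder (rcons s b)) + nu (E `&` cylinder (rcons s (~~ b))))%E.
  have mEc c := measurableI _ _ mE (mc c).
  have dis : (E `&` cylinder (rcons s b)) `&` (E `&` cylinder (rcons s (~~ b))) = set0.
    apply/seteqP; split => // y [[_ /cylinder_rcons[_ h]] [_ /cylinder_rcons[_]]].
    by rewrite h; case: b {half h}.
  rewrite -(measureU nu (mEc b) (mEc (~~ b)) dis) -setIUr; congr (nu (_ `&` _)).
  apply/seteqP; split => y; last by case=> /cylinder_rcons[].
  move=> ys; have [yb|yb] := eqVneq (y n) b; [left|right]; apply/cylinder_rcons => //.
  by split => //; rewrite -/n; case: (y n) b yb {half dis} => [] [].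
rewrite -half IH size_rcons exprS => {}IH.
have fE : nu E \is a fin_num by exact: fin_num_measure.
have fC : nu (E `&` cylinder (rcons s b)) \is a fin_num.
  by apply: fin_num_measure; exact: measurableI.
move: IH; rewrite -(fineK fE) -(fineK fC) -!EFinM -EFinD => -[IH].
by congr (_%:E); lra.
Qed.

(** Independence from all cylinders extends to all measurable sets, hence to [E] itself, and [nu E]
    equals its own square. *)
Lemma coin_zero_one E : measurable E -> add_pow 0 @^-1` E = E ->
  nu E = 0%E \/ nu (~` E) = 0%E.
Proof.
move=> mE TE.
have fE : nu E \is a fin_num by exact: fin_num_measure.
have E0 : 0 <= fine (nu E) by exact: fine_ge0.
pose m1 : {measure set (bits nat) -> \bar R} := mrestr nu mE.
pose m2 : {measure set (bits nat) -> \bar R} := mscale (NngNum E0) nu.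
have : m1 E = m2 E.
  apply: (@bits_measure_unique _ _ m1 m2) => //.
    by rewrite /m1/= /mrestr setTI ltey_eq fE.
  move=> s; rewrite /m1/= /mrestr setIC coin_cylinder_invariant// /m2/= /mscale/=.
  by rewrite nuE fineK.
rewrite /m1/= /mrestr setIid /m2/= /mscale/= fineK// => EE.
have : fine (nu E) = fine (nu E) * fine (nu E) by rewrite -fineM// -EE.
move=> {}EE.
have [e0|e0] := eqVneq (fine (nu E)) 0.
  by left; rewrite -(fineK fE) e0.
right; rewrite probability_setC// -(fineK fE).
suff -> : fine (nu E) = 1 by rewrite -EFinD subrr.
by apply: (mulfI e0); rewrite mulr1.
Qed.

End coin.

(* Junk value [0] on the all-ones sequence. *)
Definition first_zero (y : bits nat) : nat :=
  xget 0%N [set n | y n = false /\ constant_on true 0 n y].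

Lemma first_zero_eq n (y : bits nat) :
  y n = false -> constant_on true 0 n y -> first_zero y = n.
Proof.
move=> yn cn; rewrite /first_zero; case: xgetP => [m _ [ym cm]|/(_ n)/not_andP[]//].
have [nm|mn|//] := ltngtP m n.
  by move/constant_onP: cn => /(_ m); rewrite ym nm => /(_ isT).
by move/constant_onP: cm => /(_ n); rewrite yn mn => /(_ isT).
Qed.

Lemma first_zeroP (y : bits nat) : (exists n, y n = false) ->
  y (first_zero y) = false /\ constant_on true 0 (first_zero y) y.
Proof.
move=> yn; suff [n [yn0 cn]] : exists n, y n = false /\ constant_on true 0 n y.
  by rewrite (first_zero_eq yn0 cn).
have yn' : exists n, ~~ y n by case: yn => n yn; exists n; rewrite yn.
exists (ex_minn yn'); case: ex_minnP => m /negbTE ym mmin; split => //.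
apply/constant_onP => j /andP[_ jm]; apply/negPn/negP => /mmin; lia.
Qed.

Lemma measurable_first_zero : measurable_fun setT first_zero.
Proof.
pose Z n := [set y : bits nat | y n = false /\ constant_on true 0 n y].
have mZ n : measurable (Z n).
  have -> : Z n = (fun y : bits nat => ~~ y n && constant_on true 0 n y) @^-1` [set true].
    apply/seteqP; split => y /=; first by move=> [-> ->].
    by move=> /andP[/negbTE].
  rewrite -[X in measurable X]setTI.
  apply: (_ : measurable_fun setT _) => //; apply: measurable_and.
    by apply: measurable_neg; exact: measurable_coord.
  exact: measurable_constant_on.
have ZE n (y : bits nat) : Z n y -> first_zero y = n by move=> [? ?]; exact: first_zero_eq.
move=> _ B _; rewrite setTI.
(* The sequence without zeros takes the default value [0], so it belongs to the preimage exactly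
   when [B] contains [0]. *)
have -> : first_zero @^-1` B = (\bigcup_(n in B) Z n) `|`
    (if 0%N \in B then ~` (\bigcup_n Z n) else set0).
  apply/seteqP; split => y /=.
    move=> By; have [[n Zy]|nZ] := pselect (exists n, Z n y).
      by left; exists n => //; rewrite -(ZE _ _ Zy).
    right; rewrite /first_zero in By; move: By.
    case: xgetP => [n _ Zn|_ B0]; first by case: nZ; exists n.
    by rewrite ifT ?inE// => -[n _ Zn]; apply: nZ; exists n.
  move=> [[n Bn /ZE ->]//|]; case: ifPn => // /set_mem B0 nZ.
  rewrite /first_zero; case: xgetP => // n _ Zn; exfalso; apply: nZ; by exists n.
apply: measurableU; first exact: bigcup_measurable.
case: ifP => // _; apply: measurableC; exact: bigcupT_measurable.
Qed.

(* A point is bad exactly when it lies on the backward orbit of the all-ones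
   sequence, where the odometer carries infinitely far. *)
Definition good (y : bits nat) : Prop :=
  forall i, exists n, iter i (add_pow 0) y n = false.

Lemma good_add_one y : good y -> good (add_pow 0 y).
Proof. by move=> gy i; have := gy i.+1; rewrite iterSr. Qed.

Lemma good_first_zero y : good y ->
  y (first_zero y) = false /\ constant_on true 0 (first_zero y) y.
Proof. by move=> /(_ 0%N); exact: first_zeroP. Qed.

(** If [y] and [z] agree below [n], a common number of steps turns those digits into ones and leaves
    the later digits alone. A zero at [n] in either point is then its first zero, hence also that of
    the other point. *)
Lemma good_separated (y z : bits nat) : good y -> good z ->
  (forall i, first_zero (iter i (add_pow 0) y) = first_zero (iter i (add_pow 0) z)) ->
  y = z.
Proof.
move=> gy gz H; apply/funext; elim/ltn_ind => n IH.
have [i _ Hi] := reach_ones n y.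
have [y1 y2] := Hi y (fun _ _ => erefl).
have [z1 z2] := Hi z (fun j jn => esym (IH j jn)).
have key (u v : bits nat) : good u ->
    (forall j, (j < n)%N -> u j = true) -> (forall j, (j < n)%N -> v j = true) ->
    first_zero u = first_zero v -> v n = false -> u n = false.
  move=> gu un vn uv vn0; have vz : first_zero v = n.
    by apply: first_zero_eq => //; apply/constant_onP => j /andP[_]; exact: vn.
  by have [] := good_first_zero gu; rewrite uv vz.
have git u j : good u -> good (iter j (add_pow 0) u).
  by move=> gu; elim: j => //= j; exact: good_add_one.
rewrite -(y2 _ (leqnn n)) -(z2 _ (leqnn n)).
have k1 := key _ _ (git _ i gy) y1 z1 (H i).
have k2 := key _ _ (git _ i gz) z1 y1 (esym (H i)).
move: k1 k2; case: (iter i _ y n); case: (iter i _ z n) => // k1 k2.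
  by rewrite k1.
by rewrite k2.
Qed.

(** Bounds the number of columns crossed before a tall one, the origin of the bound [2 ^ N] on
    visits to the base. *)
Lemma good_reach_type N (y : bits nat) : good y ->
  exists2 i, (i < 2 ^ N)%N & (N <= first_zero (iter i (add_pow 0) y))%N.
Proof.
move=> gy; have [i iN Hi] := reach_ones N y; exists i => //.
have [y1 _] := Hi y (fun _ _ => erefl).
rewrite leqNgt; apply/negP => /y1.
have : good (iter i (add_pow 0) y).
  by elim: i {iN Hi y1} => //= j; exact: good_add_one.
by case/good_first_zero => ->.
Qed.

Section coin_good.
Context (R : realType) (nu : probability (bits nat) R).
Hypothesis nuE : forall s, nu (cylinder s) = (2^-1 ^+ size s)%:E.

Lemma coin_good : {ae nu, forall y, good y}.
Proof.
have nB i : nu.-negligible (iter i (add_pow 0) @^-1` [set (fun=> true) : bits nat]).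
  have mi : measurable_fun setT (iter i (add_pow 0)).
    elim: i => [|i IH]; first exact: measurable_id.
    exact: (measurableT_comp (measurable_add_pow 0) IH).
  exists (iter i (add_pow 0) @^-1` [set (fun=> true) : bits nat]); split => //.
    rewrite -[X in measurable X]setTI; apply: mi => //; exact: measurable_bits_set1.
  rewrite coin_iter_add_one//; [exact: coin_set1|exact: measurable_bits_set1].
apply: (negligibleS _ (negligible_bigcup nB)) => y /=.
move=> /existsNP[i /forallNP ny]; exists i => //=; apply/funext => n.
by apply/negPn/negP => /negbTE; exact: ny.
Qed.

End coin_good.

(** * Block lengths *)

(** Pigeonhole principle: among [n.+2] fractional parts of multiples of [a], two fall into the same
    of [n.+1] equal bins. *)
Lemma dirichlet_approx (R : realType) (a d : R) : 0 < a -> 0 < d ->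
  exists K L : nat, (0 < K)%N /\ `|a * K%:R - L%:R| < d.
Proof.
move=> a0 d0.
have [n nd] : exists n : nat, n.+1%:R^-1 < d.
  by have [n _ /(_ n (leqnn n))] := near_infty_natSinv_lt (PosNum d0); exists n.
pose fl j := Num.truncn (a * j%:R).
pose fr j := a * j%:R - (fl j)%:R.
have aj0 j : 0 <= a * j%:R by rewrite mulr_ge0// ltW.
have fr01 j : 0 <= fr j < 1.
  by have := truncn_itv (aj0 j); rewrite /fr /fl -natr1; lra.
pose bin (j : 'I_n.+2) : 'I_n.+1 := inord (Num.truncn (n.+1%:R * fr j)).
have binP j : (bin j)%:R <= n.+1%:R * fr j < (bin j)%:R + 1.
  have n0 : 0 < n.+1%:R :> R by rewrite ltr0n.
  have f0 : 0 <= n.+1%:R * fr j by rewrite mulr_ge0//; have := fr01 j; lra.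
  have tn : (Num.truncn (n.+1%:R * fr j) < n.+1)%N.
    rewrite truncn_lt_nat// -[ltRHS]mulr1 ltr_pM2l//.
    by have /andP[] := fr01 j.
  by have := truncn_itv f0; rewrite -[(Num.truncn _).+1%:R]natr1 /bin (inordK tn).
have [i [j [ij bij]]] : exists i j : 'I_n.+2, (i < j)%N /\ bin i = bin j.
  have ninj : ~ injective bin by move/leq_card; rewrite !card_ord ltnn.
  apply: contrapT => H; apply: ninj => i j bij; apply/val_inj.
  by have [ij|ji|//] := ltngtP i j; case: H; [exists i, j|exists j, i].
exists (j - i)%N, (fl j - fl i)%N; split; first by rewrite subn_gt0.
have flij : (fl i <= fl j)%N.
  by apply: le_truncn; rewrite ler_pM2l// ler_nat ltnW.
rewrite !natrB// ?(ltnW ij)//.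
have -> : a * (j%:R - i%:R) - ((fl j)%:R - (fl i)%:R) = fr j - fr i.
  by rewrite /fr; ring.
have := binP i; have := binP j; rewrite bij => bj bi.
have n0 : 0 < n.+1%:R :> R by rewrite ltr0n.
apply: lt_trans nd; rewrite -[ltRHS]mul1r ltr_pdivlMr//.
rewrite -[X in _ * X](gtr0_norm n0) -normrM ltr_norml; lra.
Qed.

Lemma small_combination (R : realType) (p q e : R) (M : nat) :
  0 < p -> 0 < q -> 0 < e ->
  exists K L : nat, [/\ (M <= K)%N, (M <= L)%N & `|p * K%:R - q * L%:R| <= e].
Proof.
move=> p0 q0 e0.
have M0 : 0 < M.+1%:R :> R by rewrite ltr0n.
(* The bound [p / q] excludes [L = 0]; the other one pays for the factor [q * M.+1] that appears
   when both counts are multiplied by [M.+1] to make them at least [M]. *)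
pose d := Num.min (p / q) (e / (q * M.+1%:R)).
have d0 : 0 < d by rewrite /d lt_min !divr_gt0// mulr_gt0.
have [K [L [K0 KL]]] := dirichlet_approx (divr_gt0 p0 q0) d0.
have L0 : (0 < L)%N.
  rewrite lt0n; apply/negP => /eqP L0; move: KL.
  rewrite L0 subr0 lt_min => /andP[+ _].
  have K1 : 1 <= K%:R :> R by rewrite ler1n.
  have pq0 := divr_gt0 p0 q0.
  rewrite gtr0_norm ?(mulr_gt0 pq0) ?ltr0n// ltNge => /negP; apply.
  by apply: ler_peMr => //; rewrite ltW// divr_gt0.
exists (M.+1 * K)%N, (M.+1 * L)%N; split; [by nia|by nia|].
have -> : p * (M.+1 * K)%:R - q * (M.+1 * L)%:R =
    (q * M.+1%:R) * (p / q * K%:R - L%:R).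
  by rewrite !natrM; field; rewrite gt_eqF.
have qM : 0 < q * M.+1%:R by rewrite mulr_gt0.
rewrite normrM (gtr0_norm qM) mulrC -ler_pdivlMr//.
by apply: ltW; move: KL; rewrite lt_min => /andP[].
Qed.

(* With tower heights [a n.+1 = 2 * a n + k n] and [b n.+1 = 2 * b n + l n], the
   defect [e n] is [c n.+1 - c n] for [c n = q * b n - p * a n]. *)
Lemma block_lengths (R : realType) (p q : R) : 0 < p -> 0 < q ->
  exists (k l : nat -> nat) (e : nat -> R),
  [/\ forall n, (0 < k n)%N /\ (0 < l n)%N,
      forall m n, (m < n)%N -> (k m < k n)%N,
      forall n, (4 ^ n <= k n)%N,
      forall n, p * (k n)%:R - q * (l n)%:R = \sum_(i < n) e i - e n &
      forall n, `|e n| <= 2^-1 ^+ n].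
Proof.
move=> p0 q0.
have /choice[f fP] : forall x : nat * nat, exists KL : nat * nat,
    [/\ (x.2 <= KL.1)%N, (x.2 <= KL.2)%N &
        `|p * KL.1%:R - q * KL.2%:R| <= 2^-1 ^+ x.1].
  move=> x; have e0 : 0 < 2^-1 ^+ x.1 :> R by rewrite exprn_gt0.
  by have [K [L ?]] := small_combination x.2 p0 q0 e0; exists (K, L).
(* Increments this large keep the natural-number differences [a n.+1 - 2 * a n] and
   [b n.+1 - 2 * b n] untruncated and positive, and also give the growth of [k] and
   [4 ^ n <= k n]. *)
pose g n ab := f (n, 3 * ab.1 + 3 * ab.2 + 4 ^ n + 1)%N.
pose ab := fix ab n := if n is m.+1 then
  ((ab m).1 + (g m (ab m)).1, (ab m).2 + (g m (ab m)).2)%N else (0, 0)%N.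
pose a n := (ab n).1; pose b n := (ab n).2.
have aS n : (4 * a n + 3 * b n + 4 ^ n < a n.+1)%N.
  by have [/= + _ _] := fP (n, 3 * (ab n).1 + 3 * (ab n).2 + 4 ^ n + 1)%N;
    rewrite /a /b /= /g; lia.
have bS n : (4 * b n + 3 * a n + 4 ^ n < b n.+1)%N.
  by have [/= _ + _] := fP (n, 3 * (ab n).1 + 3 * (ab n).2 + 4 ^ n + 1)%N;
    rewrite /a /b /= /g; lia.
pose c n : R := q * (b n)%:R - p * (a n)%:R.
have kS n : (a n.+1 - 2 * a n < a n.+2 - 2 * a n.+1)%N by have := aS n.+1; lia.
exists (fun n => a n.+1 - 2 * a n)%N, (fun n => b n.+1 - 2 * b n)%N,
  (fun n => c n.+1 - c n); split => [n|m n|n|n|n].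
- by have := aS n; have := bS n; lia.
- elim: n => // n IH; rewrite ltnS leq_eqVlt => /orP[/eqP ->//|/IH].
  by move=> h; exact: ltn_trans h (kS n).
- by have := aS n; lia.
- have -> : \sum_(i < n) (c i.+1 - c i) = c n.
    rewrite -(big_mkord xpredT (fun i => c i.+1 - c i)) telescope_sumr//.
    by rewrite /c /a /b /=; ring.
  rewrite !natrB ?natrM; [|by have := bS n; lia|by have := aS n; lia].
  by rewrite /c; ring.
- have [_ _] := fP (n, 3 * (ab n).1 + 3 * (ab n).2 + 4 ^ n + 1)%N.
  rewrite -normrN; congr (`|_| <= _).
  by rewrite /c /a /b /= /g !natrD; ring.
Qed.

(** * The coded tower *)

Section suspension.
Context (k l : nat -> nat) (a : bool).
Hypothesis k_gt0 : forall n, (0 < k n)%N.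
Hypothesis l_gt0 : forall n, (0 < l n)%N.
Hypothesis k_mono : forall m n, (m < n)%N -> (k m < k n)%N.

Definition height (y : bits nat) : nat := (k (first_zero y) + l (first_zero y))%N.

Definition tower_step (z : nat * bits nat) : nat * bits nat :=
  if (z.1.+1 < height z.2)%N then (z.1.+1, z.2) else (0%N, add_pow 0 z.2).

Definition tower_back (z : nat * bits nat) : nat * bits nat :=
  if z.1 == 0%N then ((height (sub_one z.2)).-1, sub_one z.2) else (z.1.-1, z.2).

Definition symbol (z : nat * bits nat) : bool :=
  if (z.1 < k (first_zero z.2))%N then a else ~~ a.

(** [Negz n] is [- n.+1]. The shift brings [x (- 2)] to position [- 1], so the present symbol sits
    at [- 1], the future to its left and the past at the nonnegative positions. *)
Definition code (z : nat * bits nat) : Omega := fun i : int =>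
  match i with
  | Posz n => symbol (iter n.+1 tower_back z)
  | Negz n => symbol (iter n tower_step z)
  end.

Lemma height_gt0 y : (0 < height y)%N.
Proof. by rewrite /height addn_gt0 k_gt0. Qed.

Lemma tower_step_lt z : (z.1 < height z.2)%N ->
  ((tower_step z).1 < height (tower_step z).2)%N.
Proof. by rewrite /tower_step; case: ifP => // _ _; exact: height_gt0. Qed.

Lemma tower_stepK z : (z.1 < height z.2)%N -> tower_back (tower_step z) = z.
Proof.
case: z => j y /= jy; rewrite /tower_step /=; case: ltnP => // jy'; rewrite /tower_back /=.
by rewrite add_powK; congr pair; lia.
Qed.

Lemma code_step z : (z.1 < height z.2)%N ->
  code (tower_step z) = bernoulli_shift (code z).
Proof.
move=> zt; apply/funext => -[[|n]|n]; rewrite /bernoulli_shift.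
- by rewrite /= tower_stepK.
- have -> : Posz n.+1 - 1 = Posz n by lia.
  by rewrite /code iterSr tower_stepK.
- have -> : Negz n - 1 = Negz n.+1 by lia.
  by rewrite /code iterSr.
Qed.

Lemma iter_tower_step i j y : (i + j < height y)%N ->
  iter i tower_step (j, y) = (i + j, y)%N.
Proof.
elim: i => //= i IH ij; rewrite IH ?(ltn_trans _ ij)//.
by rewrite /tower_step /= -addSn ij.
Qed.

Lemma iter_tower_step_height j y : (j < height y)%N ->
  iter (height y - j) tower_step (j, y) = (0%N, add_pow 0 y).
Proof.
move=> jy; have -> : (height y - j = (height y - j.+1).+1)%N by lia.
rewrite iterS iter_tower_step; last by lia.
by rewrite /tower_step /= ifF//; apply/negbTE; rewrite -leqNgt; lia.
Qed.

Lemma iter_tower_step_lt z n : (z.1 < height z.2)%N ->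
  ((iter n tower_step z).1 < height (iter n tower_step z).2)%N.
Proof. by move=> zt; elim: n => //= n; exact: tower_step_lt. Qed.

Lemma code_iter z n : (z.1 < height z.2)%N ->
  code (iter n tower_step z) = iter n bernoulli_shift (code z).
Proof.
move=> zt; elim: n => //= n IH.
by rewrite code_step ?IH//; exact: iter_tower_step_lt.
Qed.

Lemma code_level j y : (j < height y)%N ->
  code (j, y) = iter j bernoulli_shift (code (0%N, y)).
Proof.
move=> jy; rewrite -code_iter ?height_gt0// iter_tower_step addn0//.
Qed.

Lemma code_next y :
  code (0%N, add_pow 0 y) = iter (height y) bernoulli_shift (code (0%N, y)).
Proof.
have := iter_tower_step_height (height_gt0 y).
by rewrite subn0 -code_iter ?height_gt0// => ->.
Qed.

(** Every column begins with [a] and ends with [~~ a], so a symbol [a] preceded in time by [~~ a]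
    marks the bottom of a column. *)
Definition base : set Omega := [set x | x (- 1) = a /\ x 0 = ~~ a].

Lemma code_base z : (z.1 < height z.2)%N -> (code z \in base) = (z.1 == 0%N).
Proof.
case: z => j y /= jy; apply/idP/idP => [/set_mem[] /=|/eqP j0].
  rewrite /symbol /tower_back /=; case: (j =P 0%N) => //= j0.
  case: ifP => [h _|h]; last by case: a.
  by rewrite ifT ?(leq_ltn_trans (leq_pred _) h)//; case: a.
rewrite j0; apply/mem_set; split.
  by rewrite /= /symbol /= k_gt0.
rewrite /= /symbol /tower_back /= ifF//.
have := l_gt0 (first_zero (sub_one y)).
by rewrite /height => ?; apply/negbTE; rewrite -leqNgt; lia.
Qed.

(** At the time when the shorter run of [a] has ended, the longer one is still going on, by strict
    growth of [k]. *)
Lemma code0_first_zero y y' : code (0%N, y) = code (0%N, y') ->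
  first_zero y = first_zero y'.
Proof.
move=> yy'.
have key u v : code (0%N, u) = code (0%N, v) ->
    ~ (first_zero u < first_zero v)%N.
  move=> uv tt'; have kk := k_mono tt'.
  have := congr1 (fun x => x (Negz (k (first_zero u)))) uv => /=.
  have lu := l_gt0 (first_zero u).
  rewrite !iter_tower_step; [|by rewrite /height; lia..].
  by rewrite /symbol /= addn0 kk ltnn; case: a.
by have [/key|/key|//] := ltngtP (first_zero y) (first_zero y'); case.
Qed.

(** Equal codes give equal column heights, so both points return to the base together, again with
    equal codes; hence all successive first zeros agree. *)
Lemma code0_inj y y' : good y -> good y' -> code (0%N, y) = code (0%N, y') -> y = y'.
Proof.
move=> gy gy' yy'; apply: good_separated => // i; apply: code0_first_zero.
elim: i => //= i IH; rewrite !code_next IH.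
by rewrite /height (code0_first_zero IH).
Qed.

Lemma code_inj j y y' : (j < height y)%N -> (j < height y')%N ->
  good y -> good y' -> code (j, y) = code (j, y') -> y = y'.
Proof.
move=> jy jy' gy gy'; rewrite (code_level jy) (code_level jy') => jj.
apply: code0_inj => //.
elim: j jj {jy jy'} => //= j IH jj; apply: IH.
apply/funext => i; have := congr1 (fun x => x (i + 1)) jj.
by rewrite /bernoulli_shift addrK.
Qed.

Definition visits (n : nat) (z : nat * bits nat) : nat :=
  (\sum_(i < n) ((iter i tower_step z).1 == 0%N))%N.

Lemma visitsD m n z :
  visits (m + n) z = (visits m z + visits n (iter m tower_step z))%N.
Proof.
rewrite /visits big_split_ord /=; congr addn; apply: eq_bigr => i _.
by rewrite addnC iterD.
Qed.

Lemma visits_level n j y : (n <= height y - j)%N -> (visits n (j, y) <= (j == 0%N))%N.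
Proof.
move=> nj; case: n nj => [|n] nj; first by rewrite /visits big_ord0.
rewrite /visits big_ord_recl /= big1 ?addn0//= => i _.
by have := ltn_ord i => ni; rewrite -iterS iter_tower_step//; lia.
Qed.

(** Each column crossed costs one visit, at its bottom, and a column of height at least [k N] is not
    left within the remaining steps. *)
Lemma visits_base_le N y n L : (L <= k N)%N ->
  (exists2 i, (i < n)%N & (k N <= height (iter i (add_pow 0) y))%N) ->
  (visits L (0%N, y) <= n)%N.
Proof.
elim: n y L => [y L _ [//]|n IH y L LN [i ni hi]].
have [Ly|yL] := leqP L (height y).
  by apply: (leq_trans (visits_level _)); rewrite ?subn0.
have -> : L = (height y + (L - height y))%N by lia.
have := iter_tower_step_height (height_gt0 y); rewrite subn0 => hy.
rewrite visitsD hy -add1n leq_add//.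
  by apply: (leq_trans (visits_level _)); rewrite ?subn0.
apply: IH; first by lia.
case: i ni hi => [_ /= |i ni hi]; first by lia.
by exists i => //; rewrite -iterSr.
Qed.

Lemma visits_le N z : good z.2 -> (z.1 < height z.2)%N ->
  (visits (k N) z <= 2 ^ N)%N.
Proof.
case: z => j y /= gy jy.
have kle m n : (m <= n)%N -> (k m <= k n)%N.
  by rewrite leq_eqVlt => /orP[/eqP ->//|/k_mono/ltnW].
have reach u L : good u -> (L <= k N)%N -> (visits L (0%N, u) <= 2 ^ N)%N.
  move=> gu LN; apply: (visits_base_le LN); have [i iN ti] := good_reach_type N gu.
  by exists i => //; rewrite /height (leq_trans (kle _ _ ti))// leq_addr.
have [->|j0] := eqVneq j 0%N; first exact: reach.
have [Lj|jL] := leqP (k N) (height y - j).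
  by apply: (leq_trans (visits_level Lj)); rewrite (negbTE j0).
have -> : k N = (height y - j + (k N - (height y - j)))%N by lia.
rewrite visitsD iter_tower_step_height//.
have := visits_level (leqnn (height y - j)%N); rewrite (negbTE j0) leqn0 => /eqP ->.
by rewrite add0n; apply: reach; [exact: good_add_one|lia].
Qed.

End suspension.

(** * Measures carried by a tower *)

Lemma measurable_fun_nat_index (d d' : measure_display) (T : measurableType d)
  (U : measurableType d') (r : T -> nat) (F : nat -> T -> U) :
  measurable_fun setT r -> (forall n, measurable_fun setT (F n)) ->
  measurable_fun setT (fun t => F (r t) t).
Proof.
move=> mr mF _ B mB; rewrite setTI.
have -> : (fun t => F (r t) t) @^-1` B =
    \bigcup_n (r @^-1` [set n] `&` F n @^-1` B).
  apply/seteqP; split => [t Bt|t [n _ [/= <-]]//].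
  by exists (r t).
apply: bigcupT_measurable => n; apply: measurableI.
  by rewrite -[X in measurable X]setTI; exact: mr.
by rewrite -[X in measurable X]setTI; exact: mF.
Qed.

Section tower_measure.
Context (d d' : measure_display) (Y : measurableType d) (X : measurableType d')
  (R : realType) (nu : probability Y R).
Variables (h : Y -> nat) (c : nat -> Y -> X) (w : nat -> Y -> R).
Hypothesis mh : measurable_fun setT h.
Hypothesis mc : forall j, measurable_fun setT (c j).
Hypothesis mw : forall j, measurable_fun setT (w j).
Hypothesis w_gt0 : forall j y, 0 < w j y.

(** The mass that the column above [y] gives to [B]. Its integral is the image under [c] of the
    measure with density [w] on the tower, obtained without making the tower a measurable space. *)
Definition tower_sum (B : set X) (y : Y) : R :=
  \sum_(j < h y) w j y * \1_B (c j y).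

Definition tower_mass (B : set X) : \bar R := (\int[nu]_y (tower_sum B y)%:E)%E.

Lemma tower_sum_ge0 B y : 0 <= tower_sum B y.
Proof. by apply: sumr_ge0 => j _; rewrite mulr_ge0// ltW. Qed.

Lemma measurable_tower_sum B : measurable B -> measurable_fun setT (tower_sum B).
Proof.
move=> mB; rewrite /tower_sum.
apply: (measurable_fun_nat_index
  (F := fun n y => \sum_(j < n) w j y * \1_B (c j y))) => //.
move=> n.
under eq_fun do rewrite -(big_mkord xpredT (fun j => w j _ * \1_B (c j _))).
apply: measurable_sum => j; apply: measurable_funM => //.
by apply: measurableT_comp => //; exact: measurable_indic.
Qed.

Let kappa y : {measure set X -> \bar R} :=
  msum (fun j => mscale (NngNum (ltW (w_gt0 j y))) (dirac (c j y))) (h y).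

Let kappaE y B : kappa y B = (tower_sum B y)%:E.
Proof.
by rewrite /kappa /= /msum /tower_sum -sumEFin; apply: eq_bigr => j _; rewrite EFinM.
Qed.

Lemma tower_measure_exists :
  exists m : {measure set X -> \bar R}, forall B, m B = tower_mass B.
Proof.
have t0 : tower_mass set0 = 0%E.
  by rewrite /tower_mass; apply: integral0_eq => y _; rewrite -kappaE measure0.
have tge0 B : (0 <= tower_mass B)%E.
  by apply: integral_ge0 => y _; rewrite lee_fin tower_sum_ge0.
have ts : semi_sigma_additive tower_mass.
  move=> F mF tF mUF.
  have -> : tower_mass (\bigcup_n F n) = (\sum_(0 <= i <oo) tower_mass (F i))%E.
    rewrite -integral_nneseries//.
    - apply: eq_integral => y _; rewrite -kappaE measure_semi_bigcup//.
      by apply: eq_eseriesr => i _; rewrite kappaE.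
    - by move=> n; apply/measurable_EFinP; exact: measurable_tower_sum.
    - by move=> n y _; rewrite lee_fin tower_sum_ge0.
  exact: is_cvg_nneseries.
pose mx := isMeasure.Build _ _ _ tower_mass t0 tge0 ts.
by exists (HB.pack_for {measure set X -> \bar R} tower_mass mx).
Qed.

(** The right-hand side is free of [w]: any two positive weights on one tower give equivalent
    measures. *)
Lemma tower_mass_eq0 B : measurable B ->
  tower_mass B = 0%E <->
  {ae nu, forall y, forall j, (j < h y)%N -> ~ B (c j y)}.
Proof.
move=> mB.
have sum0 y : tower_sum B y = 0 <-> forall j, (j < h y)%N -> ~ B (c j y).
  split=> [/eqP|H]; last first.
    by apply: big1 => j _; rewrite indicE memNset ?mulr0//; exact: H.
  rewrite psumr_eq0 => [/allP H j jy Bj|j _]; last by rewrite mulr_ge0// ltW.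
  have := H (Ordinal jy) (mem_index_enum _); rewrite /= indicE mem_set// mulr1.
  by rewrite gt_eqF.
have -> : tower_mass B = (\int[nu]_y `|(tower_sum B y)%:E|)%E.
  by apply: eq_integral => y _; rewrite gee0_abs// lee_fin tower_sum_ge0.
rewrite ae_eq_integral_abs//; last exact/measurable_EFinP/measurable_tower_sum.
split; apply: filterS => y /=; first by move=> /(_ Logic.I)[/sum0].
by move=> /sum0 -> _.
Qed.

Lemma tower_massT_lty (C : R) : (forall y, \sum_(j < h y) w j y <= C) ->
  (tower_mass setT < +oo)%E.
Proof.
move=> wC; apply: (@le_lt_trans _ _ (\int[nu]_y (cst C%:E y))%E); last first.
  by rewrite integral_cst//= probability_setT mule1 ltry.
apply: ge0_le_integral => //.
- by move=> y _; rewrite lee_fin tower_sum_ge0.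
- by apply/measurable_EFinP; exact: measurable_tower_sum.
- move=> y _; rewrite lee_fin; apply: le_trans (wC y).
  by apply: ler_sum => j _; rewrite indicT mulr1.
Qed.

Section induced_transformation.
Variables (T : Y -> Y) (s : X -> X) (A : set X) (u1 u2 M : R).
Hypothesis h_gt0 : forall y, (0 < h y)%N.
Hypothesis mT : measurable_fun setT T.
Hypothesis nuT : forall B, measurable B -> nu (T @^-1` B) = nu B.
Hypothesis ms : measurable_fun setT s.
Hypothesis mA : measurable A.
Hypotheses (u1_ge0 : 0 <= u1) (u2_ge0 : 0 <= u2).
Hypothesis c_step : forall j y, (j.+1 < h y)%N -> c j.+1 y = s (c j y).
Hypothesis c_last : forall y, c 0 (T y) = s (c (h y).-1 y).

(** The prescribed Radon-Nikodym cocycle: [expR (- p)] and [expR q] for the conformal measure, [1]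
    and [1] for the invariant one. *)
Let phi x := if x \in A then u1 else u2.

Hypothesis w_step : forall j y, (j.+1 < h y)%N -> w j.+1 y = w j y * phi (c j y).
Hypothesis w_last : {ae nu, forall y, w 0 (T y) = w (h y).-1 y * phi (c (h y).-1 y)}.
Hypothesis w0_le : forall y, w 0 y <= M.

(* The two sums over the tower differ by the coboundary [q \o T - q]. *)
Lemma tower_mass_transform C : measurable C ->
  tower_mass C = (u1%:E * tower_mass (s @^-1` C `&` A) +
                  u2%:E * tower_mass (s @^-1` C `&` ~` A))%E.
Proof.
move=> mC.
have msC : measurable (s @^-1` C) by rewrite -[X in measurable X]setTI; exact: ms.
have mCA : measurable (s @^-1` C `&` A) by exact: measurableI.
have mCA' : measurable (s @^-1` C `&` ~` A).
  by apply: measurableI => //; exact: measurableC.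
pose J y := u1 * tower_sum (s @^-1` C `&` A) y + u2 * tower_sum (s @^-1` C `&` ~` A) y.
have JE y : J y = \sum_(j < h y) w j y * phi (c j y) * \1_C (s (c j y)).
  rewrite /J /tower_sum !mulr_sumr -big_split /=; apply: eq_bigr => j _.
  have pre x : (x \in s @^-1` C) = (s x \in C) by apply/idP/idP; rewrite !inE.
  rewrite /phi !indicE !in_setI in_setC pre.
  by case: (c j y \in A); case: (s (c j y) \in C) => /=; ring.
pose q y := w 0 y * \1_C (c 0 y).
have cob : {ae nu, forall y, J y + q y = tower_sum C y + q (T y)}.
  apply: filterS w_last => y wl; rewrite JE /q wl c_last /tower_sum.
  have := h_gt0 y; case hy : (h y) => [//|n] _.
  rewrite big_ord_recr [X in _ = X + _]big_ord_recl /=.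
  have -> : \sum_(i < n) w i y * phi (c i y) * \1_C (s (c i y)) =
      \sum_(i < n) w (bump 0 i) y * \1_C (c (bump 0 i) y).
    apply: eq_bigr => i _; rewrite /bump leq0n add1n.
    by rewrite w_step ?c_step// hy ltnS.
  by ring.
have q_ge0 y : 0 <= q y by rewrite mulr_ge0// ltW.
have J_ge0 y : 0 <= J y by rewrite addr_ge0// mulr_ge0// tower_sum_ge0.
have mq : measurable_fun setT q.
  by apply: measurable_funM => //; apply: measurableT_comp => //; exact: measurable_indic.
have mJ : measurable_fun setT J.
  by apply: measurable_funD; apply: measurable_funM => //; exact: measurable_tower_sum.
have mqT : measurable_fun setT (q \o T) by exact: measurableT_comp.
have mH := measurable_tower_sum mC.
(* This is what permits cancelling the integral of [q] below, even when the tower has infinite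
   mass. *)
have qfin : (\int[nu]_y (q y)%:E)%E \is a fin_num.
  rewrite ge0_fin_numE; last by apply: integral_ge0 => y _; rewrite lee_fin.
  apply: (@le_lt_trans _ _ (\int[nu]_y (cst M%:E y))%E); last first.
    by rewrite integral_cst//= probability_setT mule1 ltry.
  apply: ge0_le_integral => //.
  - by move=> y _; rewrite lee_fin.
  - exact/measurable_EFinP.
  - move=> y _; rewrite lee_fin; apply: le_trans (w0_le y).
    apply: ler_piMr; first exact: ltW.
    by rewrite indicE; case: (_ \in _).
have qT : (\int[nu]_y (q (T y))%:E = \int[nu]_y (q y)%:E)%E.
  pose pf : {measure set Y -> \bar R} := pushforward nu T.
  have -> : (\int[nu]_y (q y)%:E = \int[pf mT]_y (q y)%:E)%E.
    by apply: eq_measure_integral => B mB _; rewrite /= /pushforward nuT.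
  by rewrite ge0_integral_pushforward//; [exact/measurable_EFinP|move=> y _; rewrite lee_fin].
have JH : (\int[nu]_y (J y)%:E = tower_mass C)%E.
  have : (\int[nu]_y ((J y)%:E + (q y)%:E) =
          \int[nu]_y ((tower_sum C y)%:E + (q (T y))%:E))%E.
    apply: ae_eq_integral => //.
    - by apply: emeasurable_funD; exact/measurable_EFinP.
    - by apply: emeasurable_funD; exact/measurable_EFinP.
    - by apply: filterS cob => y e _; rewrite -!EFinD e.
  have mE (f : Y -> R) : measurable_fun setT f ->
      measurable_fun setT (fun y => (f y)%:E) by move=> mf; exact/measurable_EFinP.
  rewrite !ge0_integralD//; try by [exact: mE | move=> y _; rewrite lee_fin ?tower_sum_ge0].
  rewrite qT => /(congr1 (fun z => z - \int[nu]_y (q y)%:E)%E).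
  by rewrite !addeK.
rewrite -JH.
have -> : (\int[nu]_y (J y)%:E =
   \int[nu]_y (u1%:E * (tower_sum (s @^-1` C `&` A) y)%:E +
               u2%:E * (tower_sum (s @^-1` C `&` ~` A) y)%:E))%E.
  by apply: eq_integral => y _; rewrite /J EFinD !EFinM.
have mE B : measurable B -> measurable_fun setT (fun y => (tower_sum B y)%:E).
  by move=> mB; apply/measurable_EFinP; exact: measurable_tower_sum.
rewrite ge0_integralD//.
- by rewrite !ge0_integralZl//; [exact: mE | move=> y _; rewrite lee_fin tower_sum_ge0
    | exact: mE | move=> y _; rewrite lee_fin tower_sum_ge0].
- by move=> y _; rewrite -EFinM lee_fin mulr_ge0// tower_sum_ge0.
- by apply: emeasurable_funM => //; exact: mE.
- by move=> y _; rewrite -EFinM lee_fin mulr_ge0// tower_sum_ge0.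
- by apply: emeasurable_funM => //; exact: mE.
Qed.

End induced_transformation.

End tower_measure.

(** * Weights along the tower *)

Section measurable_code.
Variables (k l : nat -> nat) (a : bool).

Lemma measurable_nat_fun (d : measure_display) (T : measurableType d)
  (f : nat -> T) : measurable_fun setT f.
Proof. by []. Qed.

Lemma measurable_height : measurable_fun setT (height k l).
Proof.
apply: (measurableT_comp (f := fun n => (k n + l n)%N)); first exact: measurable_nat_fun.
exact: measurable_first_zero.
Qed.

Lemma measurable_tower_step : measurable_fun setT (tower_step k l).
Proof.
have mS : measurable_fun [set: nat * bits nat] (fun z => z.1.+1).
  by apply: (measurableT_comp (f := S)) => //; exact: measurable_fst.
apply: measurable_fun_ifT.
- apply: measurable_fun_ltn => //.
  by apply: measurableT_comp; [exact: measurable_height|exact: measurable_snd].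
- by apply: measurable_fun_pair => //; exact: measurable_snd.
- apply: measurable_fun_pair; first exact: measurable_cst.
  by apply: measurableT_comp; [exact: measurable_add_pow|exact: measurable_snd].
Qed.

Lemma measurable_tower_back : measurable_fun setT (tower_back k l).
Proof.
have ms : measurable_fun [set: nat * bits nat] (fun z => sub_one z.2).
  by apply: measurableT_comp; [exact: measurable_sub_one|exact: measurable_snd].
apply: measurable_fun_ifT.
- by apply: (measurableT_comp (f := fun n : nat => n == 0%N)) => //; exact: measurable_fst.
- apply: measurable_fun_pair => //.
  apply: (measurableT_comp (f := predn)) => //.
  by apply: measurableT_comp => //; exact: measurable_height.
- apply: measurable_fun_pair; last exact: measurable_snd.
  by apply: (measurableT_comp (f := predn)) => //; exact: measurable_fst.
Qed.

Lemma measurable_symbol : measurable_fun setT (symbol k a).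
Proof.
apply: measurable_fun_ifT => //.
apply: measurable_fun_ltn; first exact: measurable_fst.
apply: (measurableT_comp (f := k)) => //.
by apply: measurableT_comp; [exact: measurable_first_zero|exact: measurable_snd].
Qed.

Lemma measurable_code : measurable_fun setT (code k l a : nat * bits nat -> bits int).
Proof.
have mi (f : nat * bits nat -> nat * bits nat) n : measurable_fun setT f ->
    measurable_fun setT (iter n f).
  move=> mf; elim: n => [|n IH]; first exact: measurable_id.
  exact: (measurableT_comp mf IH).
apply: measurable_bits => -[n|n] /=; apply: (measurableT_comp measurable_symbol).
  exact: (mi _ n.+1 measurable_tower_back).
exact: (mi _ n measurable_tower_step).
Qed.

Lemma measurable_code_level j :
  measurable_fun setT (fun y => code k l a (j, y) : bits int).
Proof.
apply: (measurableT_comp measurable_code).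
by apply: measurable_fun_pair; [exact: measurable_cst|exact: measurable_id].
Qed.

Lemma measurable_shift : measurable_fun setT bernoulli_shift.
Proof. by apply: (@measurable_bits _ _ int) => i; exact: measurable_coord. Qed.

End measurable_code.

Section weight.
Context (R : realType) (p q : R) (k l : nat -> nat) (e : nat -> R).
Hypotheses (p_gt0 : 0 < p) (q_gt0 : 0 < q).
Hypothesis kle : forall n, p * (k n)%:R - q * (l n)%:R = \sum_(i < n) e i - e n.
Hypothesis e_le : forall n, `|e n| <= 2^-1 ^+ n.

Definition digit_sum (y : bits nat) : R := limn (series (fun n => e n * (y n)%:R)).

(** [minn j _] and the truncated difference [j - _] count the letters [a] and [~~ a] read below
    level [j]; the exponent subtracts their cost. *)
Definition weight (j : nat) (y : bits nat) : R :=
  expR (digit_sum y - (p * (minn j (k (first_zero y)))%:R -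
                       q * (j - k (first_zero y))%:R)).

Let normed_le (y : bits nat) n : `|e n * (y n)%:R| <= geometric 1 2^-1 n.
Proof.
rewrite /geometric /= mul1r normrM; apply: le_trans (e_le n).
by apply: ler_piMr => //; case: (y n); rewrite ?normr1 ?normr0.
Qed.

Let geometric_half : series (geometric (1 : R) 2^-1) @ \oo --> (2 : R).
Proof.
have := @cvg_geometric_series R 1 2^-1.
rewrite ger0_norm// invf_lt1// ltr1n => /(_ isT).
by rewrite (_ : 1 * _ = 2 :> R)//; field.
Qed.

Let is_cvg_normed (y : bits nat) : cvgn [normed series (fun n => e n * (y n)%:R)].
Proof.
apply: (@series_le_cvg _ _ (geometric 1 2^-1)) => [n|n|n|].
- exact: normr_ge0.
- by rewrite geometric_ge0// invr_ge0.
- exact: normed_le.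
- by apply/cvg_ex; exists 2.
Qed.

Let is_cvg_digit_sum (y : bits nat) : cvgn (series (fun n => e n * (y n)%:R)).
Proof. exact: normed_cvg. Qed.

Lemma digit_sum_le y : `|digit_sum y| <= 2.
Proof.
rewrite /digit_sum; apply: (le_trans (lim_series_norm (@is_cvg_normed y))).
rewrite -(cvg_lim _ geometric_half)//.
apply: lim_series_le; [exact: is_cvg_normed|by apply/cvg_ex; exists 2|].
exact: normed_le.
Qed.

Lemma measurable_digit_sum : measurable_fun setT digit_sum.
Proof.
apply: (@measurable_fun_cvg _ (bits nat) R setT
  (fun n y => series (fun n => e n * (y n)%:R) n)).
  move=> n; apply: measurable_sum => i; apply: measurable_funM => //.
  apply: (measurableT_comp (f := fun b : bool => b%:R : R)) => //.
  exact: measurable_coord.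
by move=> y _; exact: is_cvg_digit_sum.
Qed.

(** Adding one erases the ones before the first zero [n] and creates a one at [n], so the sum
    changes by [e n - \sum_(i < n) e i]. By [kle] this is minus the cost of the column: the weight
    continues consistently from its top to the next base point. *)
Lemma digit_sum_add_one y : good y -> digit_sum (add_pow 0 y) =
  digit_sum y - (p * (k (first_zero y))%:R - q * (l (first_zero y))%:R).
Proof.
move=> gy; set n := first_zero y; have [yn /constant_onP cn] := good_first_zero gy.
rewrite -/n in yn cn.
pose D := e n - \sum_(i < n) e i.
have Tlt j : (j < n)%N -> add_pow 0 y j = false.
  move=> jn; rewrite /add_pow /= ifT ?cn//.
  by apply/constant_onP => i ij; apply: cn; lia.
have Tn : add_pow 0 y n = true by rewrite /add_pow /= ifT ?yn//; exact/constant_onP.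
have Tgt j : (n < j)%N -> add_pow 0 y j = y j.
  move=> nj; rewrite /add_pow /= ifF//; apply/negbTE/constant_onP => H.
  by have := H n nj; rewrite yn.
rewrite kle -[_ - e n]opprB opprK -/D.
apply/cvg_lim => //.
have : (fun N => series (fun i => e i * (y i)%:R) N + D) @ \oo --> digit_sum y + D.
  by apply: cvgD; [exact: is_cvg_digit_sum|exact: cvg_cst].
apply: cvg_trans; apply: near_eq_cvg; exists n.+1 => // N /= nN.
rewrite /series /= (big_cat_nat (leq0n _) nN)//= [in RHS](big_cat_nat (leq0n _) nN)//=.
rewrite [X in _ + X + D](eq_big_nat _ _
  (F2 := fun i => e i * (add_pow 0 y i)%:R)); last first.
  by move=> i /andP[ni _]; rewrite Tgt.
rewrite addrAC; congr (_ + _).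
rewrite !big_nat_recr//= Tn yn mulr1 mulr0 addr0.
rewrite [X in X + D](eq_big_nat _ _ (F2 := e)); last first.
  by move=> i /andP[_ ni]; rewrite cn ?mulr1.
rewrite [X in _ = X + _]big_nat_cond [X in _ = X + _]big1 ?add0r; last first.
  by move=> i /andP[/andP[_ ni] _]; rewrite Tlt ?mulr0.
by rewrite big_mkord /D addrC subrK.
Qed.

Lemma weight_gt0 j y : 0 < weight j y.
Proof. exact: expR_gt0. Qed.

Lemma measurable_weight j : measurable_fun setT (weight j).
Proof.
apply: measurableT_comp => //; apply: measurable_funB; first exact: measurable_digit_sum.
apply: (measurableT_comp (f := fun t => p * (minn j (k t))%:R - q * (j - k t)%:R)) => //.
exact: measurable_first_zero.
Qed.

Lemma weight0 y : weight 0 y = expR (digit_sum y).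
Proof. by rewrite /weight min0n sub0n !mulr0 !subr0. Qed.

Lemma weight0_le y : weight 0 y <= expR 2.
Proof. by rewrite weight0 ler_expR (le_trans (ler_norm _))// digit_sum_le. Qed.

Lemma weight_step j y : weight j.+1 y =
  weight j y * (if (j < k (first_zero y))%N then expR (- p) else expR q).
Proof.
rewrite /weight; set t := k _.
have [jt|jt] := boolP (j < t)%N; rewrite -expRD; congr expR.
  have -> : minn j.+1 t = j.+1 by lia.
  have -> : minn j t = j by lia.
  have -> : (j.+1 - t = 0)%N by lia.
  have -> : (j - t = 0)%N by lia.
  by rewrite -natr1; ring.
have -> : minn j.+1 t = t by lia.
have -> : minn j t = t by lia.
have -> : (j.+1 - t = (j - t).+1)%N by lia.
by rewrite -[(j - t).+1%:R]natr1; ring.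
Qed.

Lemma weight_height y : good y ->
  weight (height k l y) y = weight 0 (add_pow 0 y).
Proof.
move=> gy; rewrite weight0 digit_sum_add_one// /weight /height.
by rewrite (minn_idPr (leq_addr _ _)) addKn.
Qed.

Lemma geometric_sum_le (x : R) n : 0 <= x < 1 -> \sum_(i < n) x ^+ i <= (1 - x)^-1.
Proof.
move=> /andP[x0 x1]; have x1' : 0 < 1 - x by rewrite subr_gt0.
rewrite -[leRHS]mul1r ler_pdivlMr// mulrC.
have -> : (1 - x) * \sum_(i < n) x ^+ i = 1 - x ^+ n.
  by rewrite -opprB mulNr -subrX1 opprB.
by rewrite gerBl exprn_ge0.
Qed.

Lemma weight_sum_le : exists C, forall y, \sum_(j < height k l y) weight j y <= C.
Proof.
have ex01 (x : R) : 0 < x -> 0 <= expR (- x) < 1.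
  by move=> x0; rewrite expR_ge0 expR_lt1 oppr_lt0.
have expX (x : R) n : expR (- x) ^+ n = expR (- (x * n%:R)).
  by rewrite -expRM_natr mulNr.
(* Two geometric series: over the letters [a] counted from the bottom, over the letters [~~ a]
   counted from the top. The exponent [2] bounds [digit_sum]; [4] adds the [2] by which the total
   cost of a column may fall below zero. *)
exists (expR 2 * (1 - expR (- p))^-1 + expR 4 * (1 - expR (- q))^-1) => y.
have S2 n : \sum_(i < n) `|e i| <= 2 - 2^-1 ^+ n *+ 2.
  elim: n => [|n IH]; first by rewrite big_ord0 expr0 subrr.
  rewrite big_ord_recr /= exprS; have := e_le n; lra.
set t := first_zero y.
have Slow : - 2 <= p * (k t)%:R - q * (l t)%:R.
  rewrite kle.
  have h1 : `|\sum_(i < t) e i| <= \sum_(i < t) `|e i| by exact: ler_norm_sum.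
  have := S2 t; have := e_le t; have : 0 <= (2^-1 : R) ^+ t by rewrite exprn_ge0.
  by move: h1; rewrite !ler_norml => *; lra.
have G2 : digit_sum y <= 2 by rewrite (le_trans (ler_norm _))// digit_sum_le.
have wle j : (j < height k l y)%N ->
    weight j y <= expR 2 * expR (- p) ^+ j + expR 4 * expR (- q) ^+ (height k l y - j.+1).
  move=> jh; rewrite !expX -!expRD /weight -/t.
  case: (leqP j (k t)) => jk.
    apply: le_trans (_ : _ <= expR (2 + - (p * j%:R))) _; last first.
      by rewrite lerDl expR_ge0.
    rewrite ler_expR (_ : (j - k t = 0)%N); last by lia.
    lra.
  apply: le_trans (_ : _ <= expR (4 + - (q * (height k l y - j.+1)%:R))) _; last first.
    by rewrite lerDr expR_ge0.
  rewrite ler_expR.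
  have E : (l t)%:R = (j - k t)%:R + (height k l y - j.+1)%:R + 1 :> R.
    by rewrite -natrD natr1; congr (_%:R); rewrite /height -/t in jh *; lia.
  move: Slow; rewrite E !mulrDr mulr1.
  move: (p * _) (q * (j - k t)%:R) (q * _) (digit_sum y) G2 => x1 x2 x3 z.
  by move: q_gt0 => ? ? ?; lra.
apply: le_trans (ler_sum _ _) _; first by move=> j _; exact: wle.
rewrite big_split /= -!mulr_sumr lerD// ler_wpM2l ?expR_ge0//.
  exact/geometric_sum_le/ex01.
rewrite (reindex_inj rev_ord_inj) /=.
rewrite (eq_bigr (fun i : 'I_(height k l y) => expR (- q) ^+ i)); last first.
  by move=> i _; congr (_ ^+ _); have := ltn_ord i; lia.
exact/geometric_sum_le/ex01.
Qed.

End weight.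

(** * Null sets of the coded tower *)

Section coded_tower.
Context (R : realType) (nu : probability (bits nat) R).
Hypothesis nuE : forall s, nu (cylinder s) = (2^-1 ^+ size s)%:E.
Variables (k l : nat -> nat) (a : bool).
Hypothesis k_gt0 : forall n, (0 < k n)%N.
Hypothesis l_gt0 : forall n, (0 < l n)%N.
Hypothesis k_mono : forall m n, (m < n)%N -> (k m < k n)%N.
Hypothesis k_ge : forall n, (4 ^ n <= k n)%N.

Local Notation h := (height k l).
Local Notation c j y := (code k l a (j, y)).

(** The common null sets of all positively weighted measures on the coded tower, so that the facts
    below apply to the conformal and the invariant measure alike. *)
Definition unseen (B : set Omega) : Prop :=
  {ae nu, forall y, forall j, (j < h y)%N -> ~ B (c j y)}.

Let h_gt0 y : (0 < h y)%N.
Proof. exact: height_gt0. Qed.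

Lemma ae_false : ~ {ae nu, forall y, False}.
Proof.
move=> [N [mN N0 TN]]; have : nu N = nu setT.
  by congr (nu _); apply/seteqP; split => // y _; apply: TN => /=; case.
by rewrite N0 probability_setT => /eqP; rewrite eq_sym onee_eq0.
Qed.

Lemma unseen_base : ~ unseen (base a).
Proof.
move=> ub; apply: ae_false; move: ub; rewrite /unseen.
apply: filterS => y /(_ 0%N (h_gt0 y)); apply.
by apply/set_mem; rewrite code_base.
Qed.

Lemma unseen_setT : ~ unseen setT.
Proof.
move=> ub; apply: unseen_base; move: ub; rewrite /unseen.
by apply: filterS => y H j jy _; exact: (H j jy Logic.I).
Qed.

(** Whether a level lies in [A] depends only on the base point under it, and the base points
    concerned form an odometer-invariant set. *)
Lemma unseen_zero_one A : measurable A -> bernoulli_shift @^-1` A = A ->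
  unseen A \/ unseen (~` A).
Proof.
move=> mA sA.
have sAn n x : A (iter n bernoulli_shift x) <-> A x.
  by elim: n => //= n IH; rewrite -IH -{2}sA.
have cA j y : (j < h y)%N -> A (c j y) <-> A (c 0%N y).
  by move=> jy; rewrite (code_level a k_gt0 jy).
pose E := [set y | A (c 0%N y)].
have mE : measurable E.
  by rewrite -[X in measurable X]setTI; exact: (@measurable_code_level k l a 0%N).
have TE : add_pow 0 @^-1` E = E.
  apply/seteqP; split => y; rewrite /E /= (code_next l a k_gt0).
    by move/sAn.
  by move=> ?; exact/sAn.
have [E0|E0] := coin_zero_one nuE mE TE; [left|right].
- exists E; split => // y /= /existsNP[j /not_implyP[jy /contrapT]].
  by rewrite cA.
- exists (~` E); split => //; first exact: measurableC.
  move=> y /= /existsNP[j /not_implyP[jy /contrapT]] /=.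
  by move=> nA Ey; apply: nA; rewrite cA.
Qed.

(** By injectivity of the coding, each level [j] reaches [x] from at most one good base point, and
    points are null for [nu]. *)
Lemma unseen_set1 x : unseen [set x].
Proof.
pose Z j := [set y | good y /\ (j < h y)%N /\ c j y = x].
have nZ j : nu.-negligible (Z j).
  have [[y Zy]|nZ] := pselect (exists y, Z j y).
    exists [set y]; split.
    - exact: (@measurable_bits_set1 nat y).
    - exact: (coin_set1 nuE y).
    move=> z [gz [jz zx]]; case: Zy => gy [jy yx].
    by apply: (@code_inj k l a k_gt0 l_gt0 k_mono j z y jz jy gz gy); rewrite zx yx.
  by apply: (negligibleS _ (negligible_set0 nu)) => z Zz; apply: nZ; exists z.
have /negligibleU := negligible_bigcup nZ.
move=> /(_ _ (coin_good nuE)).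
apply: negligibleS => y /= /existsNP[j /not_implyP[jy /contrapT cx]].
have [gy|?] := pselect (good y); last by right.
by left; exists j.
Qed.

(** Climbing to the top of its column brings any point to the base. Hence the preimages of the base
    exhaust the space up to a null set, as sigma-finiteness requires. *)
Lemma unseen_never_base :
  unseen (~` \bigcup_n iter n bernoulli_shift @^-1` base a).
Proof.
rewrite /unseen; apply: aeW => y j jy; apply => //; exists (h y - j)%N => //=.
rewrite -(code_iter _ k_gt0)//= iter_tower_step_height//.
by apply/set_mem; rewrite code_base.
Qed.

Lemma unseen_many_visits N :
  unseen [set x | (2 ^ N < \sum_(i < k N) (iter i bernoulli_shift x \in base a))%N].
Proof.
rewrite /unseen; apply: filterS (coin_good nuE) => y gy j jy /=.
apply/negP; rewrite -leqNgt.
apply: leq_trans (@visits_le k l k_gt0 k_mono N (j, y) gy jy).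
rewrite /visits; apply: leq_sum => i _.
rewrite -(code_iter _ k_gt0)// code_base//.
exact: (@iter_tower_step_lt k l k_gt0 (j, y)).
Qed.

Lemma measurable_base : measurable (base a).
Proof.
exact: measurableI (@measurable_coord_eq int (- 1) a)
  (@measurable_coord_eq int 0 (~~ a)).
Qed.

Lemma measurable_iter_shift n : measurable_fun setT (iter n bernoulli_shift).
Proof.
elim: n => [|n IH]; first exact: measurable_id.
exact: (measurableT_comp measurable_shift IH).
Qed.

(* A finite invariant measure would give the base frequency at most
   [2 ^ N / k N], hence zero. *)
Lemma finite_invariant_base (mu : {measure set Omega -> \bar R}) :
  (mu setT < +oo)%E -> invariant_measure bernoulli_shift mu ->
  (forall B, measurable B -> unseen B -> mu B = 0%E) -> mu (base a) = 0%E.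
Proof.
move=> muT mui mu0.
have mpre n B : measurable B -> measurable (iter n bernoulli_shift @^-1` B).
  by move=> mB; rewrite -[X in measurable X]setTI; exact: measurable_iter_shift.
have muin n B : measurable B -> mu (iter n bernoulli_shift @^-1` B) = mu B.
  elim: n B => // n IH B mB.
  have -> : iter n.+1 bernoulli_shift @^-1` B =
    iter n bernoulli_shift @^-1` (bernoulli_shift @^-1` B) by [].
  by rewrite IH ?mui//; exact: (mpre 1%N).
have mb := measurable_base.
pose f (i : nat) (x : Omega) : R := \1_(base a) (iter i bernoulli_shift x).
have mf i : measurable_fun setT (f i).
  by apply: measurableT_comp; [exact: measurable_indic|exact: measurable_iter_shift].
have f0 i x : 0 <= f i x by rewrite /f indicE.
have If i : (\int[mu]_x (f i x)%:E = mu (base a))%E.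
  rewrite -(muin i _ mb) -[X in mu X]setIT -integral_indic//; exact: mpre.
(* The number of visits in [k N] steps is integrated: by invariance each step contributes
   [mu (base a)], and almost everywhere the total is at most [2 ^ N]. *)
have le N : ((k N)%:R%:E * mu (base a) <= (2 ^ N)%:R%:E * mu setT)%E.
  have -> : ((k N)%:R%:E * mu (base a) = \int[mu]_x (\sum_(i < k N) (f i x)%:E))%E.
    rewrite ge0_integral_sum//; last 2 first.
    - by move=> i; apply/measurable_EFinP.
    - by move=> i x _; rewrite lee_fin.
    under eq_bigr do rewrite If.
    elim: (k N) => [|n IH]; first by rewrite big_ord0 mul0e.
    by rewrite big_ord_recr /= -IH -natr1 EFinD ge0_muleDl ?lee_fin// mul1e.
  rewrite -integral_cst//; apply: ae_ge0_le_integral => //.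
  - by move=> x _; apply: sume_ge0 => i _; rewrite lee_fin.
  - by apply: emeasurable_sum => i; apply/measurable_EFinP.
  - by move=> x _; rewrite lee_fin.
  pose V := [set x | (2 ^ N < \sum_(i < k N) (iter i bernoulli_shift x \in base a))%N].
  have sumf x : \sum_(i < k N) f i x =
      (\sum_(i < k N) (iter i bernoulli_shift x \in base a))%:R.
    by rewrite natr_sum; apply: eq_bigr => i _; rewrite /f indicE.
  have mV : measurable V.
    have -> : V = (fun x => \sum_(i < k N) f i x) @^-1` `](2 ^ N)%:R, +oo[.
      by apply/seteqP; split => x; rewrite /V /= in_itv/= andbT sumf ltr_nat.
    rewrite -[X in measurable X]setTI; apply: measurable_sum => //.
  exists V; split => //; first by apply: mu0 => //; exact: unseen_many_visits.
  move=> x /= H; rewrite /V /= ltnNge; apply/negP => Vx; apply: H => _.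
  by rewrite sumEFin lee_fin sumf ler_nat.
have mufin : mu setT \is a fin_num by rewrite ge0_fin_numE.
have mubfin : mu (base a) \is a fin_num.
  by rewrite ge0_fin_numE// (le_lt_trans _ muT)// le_measure ?inE.
apply/eqP; rewrite -(fineK mubfin) eqe eq_le fine_ge0// andbT leNgt; apply/negP => b0.
pose t := fine (mu setT) / fine (mu (base a)).
(* As [N < 2 ^ N], this gives [mu setT < 2 ^ N * mu (base a)]; multiplied by [2 ^ N] and combined
   with [4 ^ N <= k N], it contradicts [le N]. *)
have [N tN] : exists N : nat, t < N%:R.
  by exists (Num.truncn t).+1; exact: truncnS_gt.
have := le N; rewrite -(fineK mufin) -(fineK mubfin) -!EFinM lee_fin.
rewrite leNgt => /negP; apply.
have t2 : fine (mu setT) < 2 ^+ N * fine (mu (base a)).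
  rewrite -ltr_pdivrMr//; apply: (lt_trans tN).
  by rewrite -natrX ltr_nat ltn_expl.
rewrite natrX; apply: (@lt_le_trans _ _ (2 ^+ N * (2 ^+ N * fine (mu (base a))))).
  by rewrite ltr_pM2l// exprn_gt0.
rewrite mulrA -exprMn ler_pM2r// (_ : 2 * 2 = 4%:R :> R) -?natrX ?ler_nat ?k_ge//.
by rewrite -natrM.
Qed.

End coded_tower.

(** * The conformal measure *)

Lemma sigma_finite_measure_of (d : measure_display) (T : measurableType d)
  (R : realType) (m : {measure set T -> \bar R}) : sigma_finite setT m ->
  exists mu : {sigma_finite_measure set T -> \bar R}, forall A, mu A = m A.
Proof.
case: m => f cf sf.
pose f_sigma_finite := Measure_isSigmaFinite.Build _ T R
  (Measure.Pack cf) sf.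
by exists (HB.pack_for {sigma_finite_measure set T -> \bar R} f cf
  f_sigma_finite).
Qed.

(** Each coordinate splits an atom into two pieces, one of them null. With [x] collecting the values
    on the other pieces, the atom minus [x] is covered by countably many null sets. *)
Lemma nonatomic_bits (R : realType) (I : countType)
  (m : {finite_measure set (bits I) -> \bar R}) :
  (forall x, m [set x] = 0%E) -> nonatomic m.
Proof.
move=> m0 A [mA A0 Aat].
have fin B : measurable B -> m B \is a fin_num by move=> mB; exact: fin_num_measure.
pose H i b := A `&` [set y : bits I | y i = b].
have mH i b : measurable (H i b).
  by apply: measurableI => //; exact: measurable_coord_eq.
have split_A i : m A = (m (H i true) + m (H i false))%E.
  rewrite -measureU//.
    congr (m _); apply/seteqP; split => [y Ay|y [[]|[]]//].
    by case e: (y i); [left|right]; split.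
  by apply/seteqP; split => // y [[_ /= yt] [_ /=]]; rewrite yt.
pose x : bits I := fun i => m (H i true) != 0%E.
have other i : m (H i (~~ x i)) = 0%E.
  rewrite /x; have [//|/= Hn0] := eqVneq (m (H i true)) 0%E.
  have [|HA] := Aat _ (mH i true) (@subIsetl _ _ _); first by move=> h; rewrite h eqxx in Hn0.
  have := split_A i; rewrite HA => /(congr1 (fun z => z - m A)%E).
  by rewrite addeAC subee ?fin// add0e => <-.
pose Hn n := if unpickle n is Some i then H i (~~ x i) else set0.
have nHn n : m.-negligible (Hn n).
  rewrite /Hn; case: unpickle => [i|]; last exact: negligible_set0.
  by exists (H i (~~ x i)); split.
have [N [mN N0 HN]] := negligible_bigcup nHn.
have : (m A <= m (N `|` [set x]))%E.
  rewrite le_measure ?inE//; first by apply: measurableU => //; exact: measurable_bits_set1.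
  move=> y Ay; have [yx|yx] := pselect (y = x); [by right|left; apply: HN].
  have [i yi] : exists i, y i <> x i.
    by apply: contrapT => /forallNP h; apply: yx; apply/funext => i; exact: (contrapT (h i)).
  exists (pickle i) => //; rewrite /Hn pickleK; split => //=.
  by case: (y i) (x i) yi => [] [] /=.
rewrite leNgt => /negP; apply; apply: le_lt_trans A0.
apply: (le_trans (measureU2 _ mN (measurable_bits_set1 x))).
by rewrite [X in (X + _)%E]N0 [X in (_ + X)%E]m0 adde0.
Qed.

Definition level_code (k l : nat -> nat) (a : bool) (j : nat) (y : bits nat) : Omega :=
  code k l a (j, y).

Section type_II.
Context (R : realType) (nu : probability (bits nat) R).
Hypothesis nuE : forall s, nu (cylinder s) = (2^-1 ^+ size s)%:E.
Variables (p q : R) (k l : nat -> nat) (a : bool) (e : nat -> R).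
Hypotheses (p_gt0 : 0 < p) (q_gt0 : 0 < q).
Hypothesis k_gt0 : forall n, (0 < k n)%N.
Hypothesis l_gt0 : forall n, (0 < l n)%N.
Hypothesis k_mono : forall m n, (m < n)%N -> (k m < k n)%N.
Hypothesis k_ge : forall n, (4 ^ n <= k n)%N.
Hypothesis kle : forall n, p * (k n)%:R - q * (l n)%:R = \sum_(i < n) e i - e n.
Hypothesis e_le : forall n, `|e n| <= 2^-1 ^+ n.

Local Notation h := (height k l).
Local Notation c := (level_code k l a).
Local Notation A := [set x : Omega | x (- 1) = a].

Let h_gt0 y : (0 < h y)%N. Proof. exact: height_gt0. Qed.

Let mc j : measurable_fun setT (c j). Proof. exact: measurable_code_level. Qed.

Let mA : measurable A.
Proof. exact: (@measurable_coord_eq int). Qed.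

Let in_A j y : (c j y \in A) = (j < k (first_zero y))%N.
Proof.
apply/idP/idP; rewrite inE /level_code /= /symbol /=; case: ifP => //.
by case: a.
Qed.

Let shift_step j y : (j.+1 < h y)%N -> c j.+1 y = bernoulli_shift (c j y).
Proof.
move=> jy; rewrite /level_code -(@code_step k l a (j, y)) /=; last exact: ltnW.
by rewrite /tower_step /= jy.
Qed.

Let shift_last y : c 0 (add_pow 0 y) = bernoulli_shift (c (h y).-1 y).
Proof.
have hy : ((h y).-1 < h y)%N by rewrite prednK.
rewrite /level_code -(@code_step k l a (_, y)) //=.
by rewrite /tower_step /= prednK// ltnn.
Qed.

Lemma tower_mass_shift (w : nat -> bits nat -> R) (u1 u2 M : R) C :
  (forall j, measurable_fun setT (w j)) -> (forall j y, 0 < w j y) ->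
  0 <= u1 -> 0 <= u2 ->
  (forall j y, w j.+1 y = w j y * (if (j < k (first_zero y))%N then u1 else u2)) ->
  (forall y, good y -> w (h y) y = w 0 (add_pow 0 y)) ->
  (forall y, w 0 y <= M) -> measurable C ->
  tower_mass nu h c w C =
  (u1%:E * tower_mass nu h c w (bernoulli_shift @^-1` C `&` A) +
   u2%:E * tower_mass nu h c w (bernoulli_shift @^-1` C `&` ~` A))%E.
Proof.
move=> mw w0 u10 u20 ws wh wM mC.
apply: (@tower_mass_transform _ _ _ _ _ nu h c w _ _ _ _ (add_pow 0)
  bernoulli_shift A u1 u2 M) => //.
- exact: measurable_height.
- exact: measurable_add_pow.
- by move=> B; exact: coin_add_one.
- exact: measurable_shift.
- by move=> j y jy; rewrite in_A ws.
- apply: filterS (coin_good nuE) => y gy.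
  by rewrite in_A -ws prednK// wh.
Qed.

Let unseen_mass (w : nat -> bits nat -> R) (B : set Omega) :
  (forall j, measurable_fun setT (w j)) -> (forall j y, 0 < w j y) -> measurable B ->
  tower_mass nu h c w B = 0%E <-> unseen nu k l a B.
Proof. by move=> mw w0 mB; apply: tower_mass_eq0 => //; exact: measurable_height. Qed.

(** Ergodicity and Krieger type depend on [m] only through its null sets, so no weight enters the
    hypothesis. *)
Lemma type_II_tower (m : probability Omega R) :
  (forall B, measurable B -> m B = 0%E <-> unseen nu k l a B) ->
  ergodic bernoulli_shift m /\ type_II_infty bernoulli_shift m.
Proof.
move=> mN; pose w1 : nat -> bits nat -> R := fun _ _ => 1.
have [mu muE] : exists mu : {measure set Omega -> \bar R},
    forall B, mu B = tower_mass nu h c w1 B.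
  apply: tower_measure_exists => //; first exact: measurable_height.
  by move=> j; exact: measurable_cst.
have muN B : measurable B -> mu B = 0%E <-> unseen nu k l a B.
  move=> mB; rewrite muE; apply: (@unseen_mass w1) => // j; exact: measurable_cst.
have mub := measurable_base a.
have mui : invariant_measure bernoulli_shift mu.
  move=> C mC.
  have mC' : measurable (bernoulli_shift @^-1` C).
    by rewrite -[X in measurable X]setTI; exact: measurable_shift.
  have -> : mu C = (mu (bernoulli_shift @^-1` C `&` A) +
                    mu (bernoulli_shift @^-1` C `&` ~` A))%E.
    rewrite !muE; have := @tower_mass_shift w1 1 1 1 C; rewrite !mul1e; apply=> //.
      by move=> j; exact: measurable_cst.
    by move=> j y; case: ifP; rewrite /w1 mulr1.
  rewrite -measureU//.
  - by rewrite -setIUr setUv setIT.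
  - exact: measurableI.
  - by apply: measurableI => //; exact: measurableC.
  - by rewrite setIACA setICr setI0.
(* Applied to [mu] itself this yields [mu setT = +oo]; applied to an arbitrary [mu'] it yields the
   last clause of the type. *)
have no_finite (mu' : {measure set Omega -> \bar R}) : (mu' setT < +oo)%E ->
    invariant_measure bernoulli_shift mu' -> equivalent_measures mu' m -> False.
  move=> mu'T mu'i [/null_content_dominatesP dom1 /null_content_dominatesP dom2].
  apply: (@unseen_base R nu k l a k_gt0 l_gt0); apply/mN => //; apply: dom2 => //.
  apply: (@finite_invariant_base _ nu nuE k l a) => // B mB uB; apply: dom1 => //; exact/mN.
have mum : equivalent_measures mu m.
  split; apply/null_content_dominatesP => B mB.
    by move/(mN _ mB)/(muN _ mB).
  by move/(muN _ mB)/(mN _ mB).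
(* A column meets the base at level [0] and nowhere else. *)
have m_base : mu (base a) = 1%E.
  rewrite muE /tower_mass (_ : (fun y => _) = cst 1%E).
    by rewrite integral_cst//= probability_setT mul1e.
  apply/funext => y; congr (_%:E); rewrite /tower_sum.
  rewrite -(big_mkord xpredT (fun j => w1 j y * \1_(base a) (c j y))).
  rewrite -(prednK (h_gt0 y)) big_nat_recl// indicE code_base//= mulr1 /w1.
  rewrite big_nat_cond big1 ?addr0// => j /andP[/andP[_ jy] _].
  by rewrite indicE /level_code code_base /= ?mulr0// -ltn_predRL.
have muoo : mu setT = +oo%E.
  apply/eqP; apply/negPn/negP => muT.
  by apply: (no_finite mu) => //; rewrite ltey.
split.
  move=> B mB sB; have [u|u] := unseen_zero_one nuE l a k_gt0 mB sB; [left|right].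
    by apply/mN.
  by apply/mN => //; exact: measurableC.
split.
- apply: (@nonatomic_bits R int m) => x; apply/mN; last exact: unseen_set1.
  exact: (@measurable_bits_set1 int).
- have mpre n : measurable (iter n bernoulli_shift @^-1` base a).
    by rewrite -[X in measurable X]setTI; exact: measurable_iter_shift.
  have sfin : sigma_finite setT mu.
    (* Index [0] holds the null set of points that never reach the base; every other piece has mass
       [1] by invariance. *)
    exists (fun n => if n is n'.+1 then iter n' bernoulli_shift @^-1` base a
      else ~` \bigcup_n iter n bernoulli_shift @^-1` base a).
      apply/seteqP; split => // x _.
      have [[n _ nx]|nx] := pselect ((\bigcup_n iter n bernoulli_shift @^-1` base a) x).
        by exists n.+1.
      by exists 0%N.
    case=> [|n]; split => //.
    + by apply: measurableC; exact: bigcupT_measurable.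
    + rewrite (_ : mu _ = 0%E) ?ltry//; apply/muN; last exact: unseen_never_base.
      by apply: measurableC; exact: bigcupT_measurable.
    + suff -> : mu (iter n bernoulli_shift @^-1` base a) = 1%E by rewrite ltry.
      elim: n => // n IH.
      rewrite (_ : _ @^-1` _ = bernoulli_shift @^-1` (iter n bernoulli_shift @^-1` base a)).
        by rewrite mui.
      by apply/seteqP; split => x /=; rewrite -iterSr.
  have [mu' mu'E] := sigma_finite_measure_of sfin.
  have [mu'm mmu'] := mum; exists mu'; split.
  + exact: etrans (mu'E _) muoo.
  + by move=> B mB; exact: etrans (mu'E _) (etrans (mui B mB) (esym (mu'E B))).
  + split => B nB C mC CB; first exact: etrans (mu'E C) (mu'm B nB C mC CB).
    apply: (mmu' B _ C mC CB) => D mD DB.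
    exact: etrans (esym (mu'E D)) (nB D mD DB).
- move=> [mu' [_ mui' mum']]; apply: (no_finite mu') => //.
  by rewrite -ge0_fin_numE// fin_num_measure.
Qed.

(** The second clause is conformality written with preimages, the density being constant on [A] and
    off [A]. It is linear in the measure, hence survives normalization. *)
Lemma conformal_tower : exists m : probability Omega R,
  (forall B, measurable B -> m B = 0%E <-> unseen nu k l a B) /\
  forall C, measurable C -> m C =
    ((expR (- p))%:E * m (bernoulli_shift @^-1` C `&` A) +
     (expR q)%:E * m (bernoulli_shift @^-1` C `&` ~` A))%E.
Proof.
pose w := @weight R p q k e.
have mw j : measurable_fun setT (w j) by exact: measurable_weight.
have w0 j y : 0 < w j y by exact: weight_gt0.
have [m mE] : exists m : {measure set Omega -> \bar R},
    forall B, m B = tower_mass nu h c w B.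
  by apply: tower_measure_exists => //; exact: measurable_height.
have mN B : measurable B -> m B = 0%E <-> unseen nu k l a B.
  by move=> mB; rewrite mE; apply: (@unseen_mass w).
have m0 : m setT != 0%E.
  apply/eqP => /mN; move=> /(_ measurableT).
  exact: (@unseen_setT R nu k l a k_gt0 l_gt0).
have moo : (m setT < +oo)%E.
  have [K KE] := weight_sum_le p_gt0 q_gt0 kle e_le.
  by rewrite mE; apply: tower_massT_lty KE => //; exact: measurable_height.
have [P PE] := normalized_probability m0 moo.
have r0 : 0 < (fine (m setT))^-1 by rewrite invr_gt0 fine_gt0// lt0e m0 measure_ge0.
exists P; split => [B mB|C mC].
  rewrite PE -mN//; split=> [/eqP|->]; last by rewrite mul0e.
  by rewrite mule_eq0 eqe (gt_eqF r0) orbF => /eqP.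
rewrite !PE {1}mE.
rewrite (@tower_mass_shift w (expR (- p)) (expR q) (expR 2) C) ?expR_ge0//.
- by rewrite -!mE ge0_muleDl ?muleA// mule_ge0// lee_fin expR_ge0.
- by move=> j y; exact: weight_step.
- by move=> y gy; exact: weight_height.
- by move=> y; exact: weight0_le.
Qed.

End type_II.

(** The sign of [beta] decides which symbol has positive cost; calling that symbol [a] treats both
    signs at once. *)
Lemma potential_cost (R : realType) (theta beta : R) : 0 < theta -> beta != 0 ->
  exists (a : bool) (p q : R), [/\ 0 < p, 0 < q &
    forall x : Omega, - beta * potential theta x = if x (- 1) == a then - p else q].
Proof.
move=> t0 b0; have [b1|b1] := ltP 0 beta.
  exists false, beta, (beta * theta); split => // [|x]; first exact: mulr_gt0.
  by rewrite /potential; case: (x (- 1)) => /=; ring.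
have {}b1 : beta < 0 by rewrite lt_neqAle b0.
exists true, (- beta * theta), (- beta); split => [||x].
- by rewrite mulr_gt0// oppr_gt0.
- by rewrite oppr_gt0.
- by rewrite /potential; case: (x (- 1)) => /=; ring.
Qed.

Theorem theorem1p1 (R : realType) (theta : R) (htheta : 0 < theta)
    (beta : R) (hbeta : beta != 0) :
  exists m : probability Omega R,
    [/\ ergodic bernoulli_shift m,
        conformal bernoulli_shift beta (potential theta) m &
        type_II_infty bernoulli_shift m].
Proof.
have [a [p [q [p0 q0 cost]]]] := potential_cost htheta hbeta.
have [k [l [e [kl0 k_mono k_ge kle e_le]]]] := block_lengths p0 q0.
have k0 n := (kl0 n).1; have l0 n := (kl0 n).2.
have [nu nuE] := coin_measure R.
have [m [mN mC]] := conformal_tower nuE a p0 q0 k0 l0 kle e_le.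
have [erg II] := type_II_tower nuE k0 l0 k_mono k_ge mN.
exists m; split => // B mB.
pose unshift : Omega -> Omega := fun x i => x (i + 1).
have munshift : measurable_fun setT unshift.
  by apply: (@measurable_bits _ _ int) => i; exact: measurable_coord.
have shiftK : cancel bernoulli_shift unshift.
  by move=> x; apply/funext => i; rewrite /unshift /bernoulli_shift addrK.
have unshiftK : cancel unshift bernoulli_shift.
  by move=> x; apply/funext => i; rewrite /unshift /bernoulli_shift subrK.
have BE : bernoulli_shift @` B = unshift @^-1` B.
  apply/seteqP; split => [_ [x Bx <-] /=|x /= Bx]; first by rewrite shiftK.
  by exists (unshift x).
have mSB : measurable (bernoulli_shift @` B).
  by rewrite BE -[X in measurable X]setTI; exact: munshift.
have pre : bernoulli_shift @^-1` (bernoulli_shift @` B) = B.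
  by rewrite BE; apply/seteqP; split => x /=; rewrite shiftK.
(* The preimage identity is used at the image of [B], whose preimage is [B] because the shift is
   injective; its two terms are the integrals over the parts of [B] where the density is
   constant. *)
rewrite [LHS](mC _ mSB) pre.
set A := [set x : Omega | x (- 1) = a].
have mA : measurable A by exact: (@measurable_coord_eq int).
have mBA : measurable (B `&` A) by exact: measurableI.
have mBA' : measurable (B `&` ~` A) by apply: measurableI => //; exact: measurableC.
have BU : B = (B `&` A) `|` (B `&` ~` A) by rewrite -setIUr setUv setIT.
have const D r : measurable D ->
    (forall x, D x -> expR (- beta * potential theta x) = r) ->
    (\int[m]_(x in D) (expR (- beta * potential theta x))%:E = r%:E * m D)%E.
  move=> mD Dr; rewrite -integral_cst//; apply: eq_integral => x /set_mem Dx.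
  by rewrite Dr.
have cA x : (B `&` A) x -> expR (- beta * potential theta x) = expR (- p).
  by move=> [_ xa]; rewrite cost xa eqxx.
have cA' x : (B `&` ~` A) x -> expR (- beta * potential theta x) = expR q.
  by move=> [_ /eqP/negbTE xa]; rewrite cost xa.
rewrite [in RHS]BU ge0_integral_setU//.
- by rewrite (const _ _ mBA cA) (const _ _ mBA' cA').
- apply/measurable_funU => //; split; apply/measurable_EFinP.
    by apply: (eq_measurable_fun (cst (expR (- p)))) => // x /set_mem/cA ->.
  by apply: (eq_measurable_fun (cst (expR q))) => // x /set_mem/cA' ->.
- by apply/disj_setPS => x [[_ xA] [_ nxA]]; exact: (nxA xA).
Qed.
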